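(* Let $(\mathcal{A},E,\mathcal{B})$ be a tracial $\mathcal{B}$-valued probability space and let $a_1,a_2\in\tilde{\mathcal{A}}^{sa}$ be two random variables whose Cauchy transforms agree on $\Omega(\mathcal{B})$, i.e. $G^{(2n)}_{a_1}(b)=G^{(2n)}_{a_2}(b)$ for all $n\in\mathbb{N}$ and all $b\in\Omega_n(\mathcal{B})$. Then the tracial W$^*$-algebras $\mathcal{A}_1=\{a_1,\mathcal{B}\}''$ and $\mathcal{A}_2=\{a_2,\mathcal{B}\}''$ are spatially isomorphic.
   Context: A tracial $\mathcal{B}$-valued probability space $(\mathcal{A},E,\mathcal{B})$ consists of a von Neumann algebra $\mathcal{A}$ with a faithful normal tracial state $\tau$, a unital von Neumann subalgebra $\mathcal{B}\subset\mathcal{A}$, and a $\tau$-preserving conditional expectation $E:\mathcal{A}\to\mathcal{B}$ (unital, $\mathcal{B}$-bimodular, completely positive). $\tilde{\mathcal{A}}$ is the $*$-algebra of closed densely defined operators affiliated with $\mathcal{A}$ (acting on $L^2(\mathcal{A},\tau)$), and $\tilde{\mathcal{A}}^{sa}$ is its set of self-adjoint elements. For $a\in\tilde{\mathcal{A}}^{sa}$, the resolvent set of $a\otimes 1_n$ is the set of $b\in M_n(\mathcal{B})$ such that $b-a\otimes 1_n$ has an inverse in $M_n(\mathcal{A})$. The Cauchy transform of $a$ is the family $G_a=\{G_a^{(n)}\}_n$, $G_a^{(n)}(b)=E_n[(b-a\otimes 1_n)^{-1}]$, where $E_n=E\otimes 1_n$ is $E$ applied entrywise, defined for $b$ in the resolvent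 set of $a\otimes 1_n$. $\mathcal{B}^{+}$ (resp. $\mathcal{B}^-$) is the set of $b\in\mathcal{B}$ with $\Im(b)>\epsilon 1$ (resp. $\Im(b)<-\epsilon1$) for some $\epsilon>0$, where $\Im(b)=(b-b^* )/2i$. $\Omega_n(\mathcal{B})\subset M_{2n}(\mathcal{B})$ is the union of all open norm balls $B_r(b)$, where $b=\mathrm{diag}(b_1,b_2,\dots,b_{2n})$ with $b_1,b_3,\dots,b_{2n-1}\in\mathcal{B}^+$, $b_2,b_4,\dots,b_{2n}\in\mathcal{B}^-$, and $r>0$ is the largest constant with $r1\le|\Im(b_i)|$ for all $i$. One sets $\Omega(\mathcal{B})=\bigsqcup_{n\ge1}\Omega_n(\mathcal{B})$. $\Omega_n(\mathcal{B})$ is contained in the resolvent set of $a\otimes 1_{2n}$ for every $a\in\tilde{\mathcal{A}}^{sa}$. For $a\in\tilde{\mathcal{A}}^{sa}$, $\{a,\mathcal{B}\}''$ denotes the von Neumann algebra generated by $\mathcal{B}$ and the spectral projections of $a$ (equivalently by $\mathcal{B}$, $(a+i)^{-1}$, $(a-i)^{-1}$). Spatially isomorphic means that there is a unitary $U:L^2(\mathcal{A}_1,\tau)\to L^2(\mathcal{A}_2,\tau)$ with $U\mathcal{A}_1U^*=\mathcal{A}_2$ (each $\mathcal{A}_i$ acting on $L^2(\mathcal{A}_i,\tau)$ by left multiplication). *)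

(* Defs.v *)
From HB Require Import structures.
From mathcomp Require Import all_boot all_order all_algebra.
From mathcomp Require Import complex.
From mathcomp Require Import all_classical all_reals all_analysis.
Set Implicit Arguments.
Unset Strict Implicit.
Unset Printing Implicit Defensive.
Import Order.TTheory GRing.Theory Num.Theory.
Import numFieldNormedType.Exports.
Local Open Scope classical_set_scope.
Local Open Scope ring_scope.

(* Complex Hilbert spaces; the inner product is linear in its first argument. *)
Record hilbertType (R : realType) := Hilbert {
  hsort :> completeNormedModType R[i];
  dot : {dot hsort for (@Num.conj R[i])};
  dotE : forall x : hsort, `|x| ^+ 2 = dot x x
}.

Section BoundedOperators.
Variables (R : realType) (H : hilbertType R).
Implicit Types (S T : H -> H) (M : set (H -> H)).

Definition bounded_op : set (H -> H) :=
  [set T : H -> H | linear T /\ continuous T].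

(* Total by choice: every bounded operator has exactly one bounded adjoint. *)
Definition adj T : H -> H :=
  xget 0 [set S | bounded_op S /\ forall x y, dot H (T x) y = dot H x (S y)].

(* [0 <= z] in [R[i]] says that z is real and nonnegative. *)
Definition positive_op T := forall v, 0 <= dot H (T v) v.

Definition le_op S T := positive_op (T - S).

Definition scalar_op (c : R[i]) : H -> H := fun v => c *: v.

Definition unitary_op T := adj T \o T = id /\ T \o adj T = id.

(* |T|, the positive square root of T^* T. *)
Definition abs_op T : H -> H :=
  xget 0 [set S | [/\ bounded_op S, positive_op S & S \o S = adj T \o T]].

Definition Im_op T : H -> H := (2%:R * 'i)^-1 *: (T - adj T).

Definition commutant M : set (H -> H) :=
  [set T | bounded_op T /\ forall S, M S -> T \o S = S \o T].

Definition von_neumann M :=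
  [/\ M `<=` bounded_op, forall T, M T -> M (adj T) &
      commutant (commutant M) = M].

Definition generated_vN M : set (H -> H) := smallest von_neumann M.

End BoundedOperators.

(* An n x n matrix of operators on H acts on H^n. *)
Section OperatorMatrices.
Variables (R : realType) (H : hilbertType R) (n : nat).
Implicit Types (x : 'M[H -> H]_n) (v : 'I_n -> H).

Definition mx_over (M : set (H -> H)) : set 'M[H -> H]_n :=
  [set x | forall i j, M (x i j)].

Definition mx_act x v : 'I_n -> H := fun i => \sum_j x i j (v j).

Definition positive_mx x :=
  forall v, 0 <= \sum_i dot H (mx_act x v i) (v i).

Definition opnorm x : R :=
  inf [set s : R | 0 <= s /\ forall v,
         \sum_i `|mx_act x v i| ^+ 2
           <= (s ^+ 2)%:C%C * \sum_i `|v i| ^+ 2 ].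

End OperatorMatrices.

(* Faithful normal tracial states on an algebra M of operators. *)
Section TracialStates.
Variables (R : realType) (H : hilbertType R).
Variables (M : set (H -> H)) (tau : (H -> H) -> R[i]).

Definition is_state :=
  [/\ forall c x y, M x -> M y -> tau (c *: x + y) = c * tau x + tau y,
      forall x, M x -> positive_op x -> 0 <= tau x &
      tau id = 1].

Definition is_tracial := forall x y, M x -> M y -> tau (x \o y) = tau (y \o x).

Definition is_faithful :=
  forall x, M x -> positive_op x -> tau x = 0 -> x = 0.

(* Normality: tau preserves suprema of bounded upward directed families of
   positive elements of M. *)
Definition is_normal := forall (D : set (H -> H)) (s : H -> H),
  D !=set0 -> (forall x, D x -> M x /\ positive_op x) ->
  (forall x y, D x -> D y -> exists z, [/\ D z, le_op x z & le_op y z]) ->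
  M s -> (forall x, D x -> le_op x s) ->
  (forall t, M t -> (forall x, D x -> le_op x t) -> le_op s t) ->
  supremums [set tau x | x in D] (tau s).

End TracialStates.

(* Tracial B-valued probability spaces (A, E, B), with A acting by left
   multiplication on H = L^2(A, tau): H carries the vector xi, the class of 1,
   such that x |-> x xi has dense range in H and tau(y^* x) = <x xi, y xi>.
   Only the values of tau and E on A matter. *)
Record tracial_space (R : realType) (H : hilbertType R) := TracialSpace {
  algA : set (H -> H);
  algB : set (H -> H);
  trace : (H -> H) -> R[i];
  cexp : (H -> H) -> (H -> H);
  one_vec : H;
  algA_vN : von_neumann algA;
  algB_vN : von_neumann algB;
  algB_sub : algB `<=` algA;
  trace_state : is_state algA trace;
  trace_tracial : is_tracial algA trace;
  trace_faithful : is_faithful algA trace;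
  trace_normal : is_normal algA trace;
  one_vec_cyclic : closure [set x one_vec | x in algA] = setT;
  one_vecE : forall x y, algA x -> algA y ->
    trace (adj y \o x) = dot H (x one_vec) (y one_vec);
  cexp_range : forall x, algA x -> algB (cexp x);
  cexp_linear : forall c x y, algA x -> algA y ->
    cexp (c *: x + y) = c *: cexp x + cexp y;
  cexp_unital : cexp id = id;
  cexp_bimodular : forall b x b', algB b -> algA x -> algB b' ->
    cexp (b \o x \o b') = b \o cexp x \o b';
  cexp_cp : forall n (x : 'M[H -> H]_n), mx_over algA x -> positive_mx x ->
    positive_mx (map_mx cexp x);
  cexp_trace : forall x, algA x -> trace (cexp x) = trace x
}.

(* An unbounded operator a is given by its graph, a set of pairs (v, a v). *)
Section UnboundedOperators.
Variables (R : realType) (H : hilbertType R).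
Implicit Types (a : set (H * H)) (A B : set (H -> H)).

Definition closed_densely_defined a :=
  [/\ forall (c : R[i]) p q, a p -> a q -> a (c *: p.1 + q.1, c *: p.2 + q.2),
      forall y, a (0, y) -> y = 0,
      closed a &
      closure [set p.1 | p in a] = setT].

Definition affiliated A a :=
  closed_densely_defined a /\
  forall u, commutant A u -> unitary_op u ->
    [set (u p.1, u p.2) | p in a] = a.

Definition adjoint_graph a : set (H * H) :=
  [set p | forall q, a q -> dot H q.2 p.1 = dot H q.1 p.2].

Definition affiliated_sa A a := affiliated A a /\ adjoint_graph a = a.

(* r is the bounded everywhere defined inverse of a + z. *)
Definition shift_inverse a (z : R[i]) (r : H -> H) :=
  [/\ bounded_op r,
      forall x y, a (x, y) -> r (y + z *: x) = x &
      forall u, a (r u, u - z *: r u)].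

(* {a, B}'', with a entering through (a + i)^-1 and (a - i)^-1, which generate
   the same von Neumann algebra as its spectral projections. *)
Definition vN_adjoin a B : set (H -> H) :=
  generated_vN (B `|` shift_inverse a 'i `|` shift_inverse a (- 'i)).

(* c in M_n(A) is the inverse of b - a (x) 1_n, whose domain is D(a)^n. *)
Definition mx_inverse A a n (b c : 'M[H -> H]_n) :=
  [/\ mx_over A c,
      forall v w : 'I_n -> H, (forall i, a (v i, w i)) ->
        mx_act c (fun i => mx_act b v i - w i) = v &
      forall (u : 'I_n -> H) i,
        a (mx_act c u i, mx_act b (mx_act c u) i - u i)].

Definition resolvent_set A a n : set 'M[H -> H]_n :=
  [set b | exists c, mx_inverse A a b c].

(* The inverse is unique; the value off the resolvent set is irrelevant. *)
Definition resolvent A a n (b : 'M[H -> H]_n) : 'M[H -> H]_n :=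
  xget 0 [set c | mx_inverse A a b c].

Definition cauchy_transform (P : tracial_space H) a n (b : 'M[H -> H]_n) :
  'M[H -> H]_n := map_mx (cexp P) (resolvent (algA P) a b).

End UnboundedOperators.

Section Omega.
Variables (R : realType) (H : hilbertType R) (B : set (H -> H)).

(* Since e > 0 is arbitrary, strict and weak inequality in the operator order
   give the same half-planes. *)
Definition upper_half : set (H -> H) :=
  [set b | B b /\
     exists2 e : R, 0 < e & le_op (scalar_op e%:C%C) (Im_op b)].

Definition lower_half : set (H -> H) :=
  [set b | B b /\
     exists2 e : R, 0 < e & le_op (Im_op b) (scalar_op (- e%:C%C))].

Definition largest_bound n (b : 'I_n -> H -> H) (r : R) :=
  let bound (s : R) :=
    forall i, le_op (scalar_op s%:C%C) (abs_op (Im_op (b i))) in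
  bound r /\ forall s, bound s -> s <= r.

(* Indices start at 0: the paper's b_1, b_3, ... are the even entries here. *)
Definition Omega n : set 'M[H -> H]_(2 * n) :=
  [set c | mx_over B c /\
     exists (b : 'I_(2 * n) -> H -> H) (r : R),
     [/\ forall i : 'I_(2 * n),
           if odd i then lower_half (b i) else upper_half (b i),
         0 < r, largest_bound b r &
         opnorm (c - \matrix_(i, j) (if i == j then b i else 0)) < r]].

End Omega.

Section SpatialIsomorphism.
Variables (R : realType) (H : hilbertType R).
Implicit Types (K : set H) (M : set (H -> H)).

(* U is only relevant on K1. *)
Definition unitary_between K1 K2 (U : H -> H) :=
  [/\ forall (c : R[i]) x y, K1 x -> K1 y -> U (c *: x + y) = c *: U x + U y,
      forall x y, K1 x -> K1 y -> dot H (U x) (U y) = dot H x y &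
      U @` K1 = K2].

(* For a von Neumann subalgebra M of A, L^2(M, tau) is the closure of M in
   L^2(A, tau), with M acting by restriction. *)
Definition L2 (P : tracial_space H) M : set H :=
  closure [set x (one_vec P) | x in M].

(* The equality U x U^* = y of operators on L^2(M2, tau) reads U x = y U on
   L^2(M1, tau). *)
Definition spatially_isomorphic (P : tracial_space H) M1 M2 :=
  exists U : H -> H,
  [/\ unitary_between (L2 P M1) (L2 P M2) U,
      forall x, M1 x -> exists2 y, M2 y &
        forall v, L2 P M1 v -> U (x v) = y (U v) &
      forall y, M2 y -> exists2 x, M1 x &
        forall v, L2 P M1 v -> U (x v) = y (U v)].

End SpatialIsomorphism.

(* Main.v *)
Require Import Defs.
From mathcomp Require Import all_boot all_order all_algebra.
From mathcomp Require Import complex ring lra.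
From mathcomp Require Import all_classical all_reals all_analysis.
Set Implicit Arguments.
Unset Strict Implicit.
Unset Printing Implicit Defensive.
Import Order.TTheory GRing.Theory Num.Theory.
Import numFieldNormedType.Exports.
Local Open Scope classical_set_scope.
Local Open Scope ring_scope.

(* Write xi for the vector of 1 and r_k^± for (a_k ± i)^-1.  For a block upper
   triangular b = diag(i, -i, i, ...) + N in Omega_n with N small and strictly
   upper triangular, the corner entry of (b - a)^-1 is, up to a scalar, an
   arbitrary word r^± b_1 r^± b_2 ... r^± with b_j in B.  Hence all moments of
   words in B and r_k^± agree for k = 1, 2, and w(a_1) xi |-> w(a_2) xi extends
   to a partial isometry U of L^2(A) from L^2(A_1) onto L^2(A_2) that
   intertwines the generators.  For x in A_1 the operator T = U x U^* commutes
   with the compressions to L^2(A_2) of elements of A_2', so n xi |-> n T xi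
   (n in A_2') is well defined and bounded; as A' xi is dense in H, it extends
   to an operator y of A_2'' = A_2 that agrees with T on L^2(A_2). *)

(** * Hilbert spaces *)

(** The obstacle is that moments only control the vectors w xi, hence the subspaces L^2(A_1) and
    L^2(A_2), whereas elements of A_2 act on all of H: U x U^* vanishes off L^2(A_2) and need not
    lie in A_2. The operator of A_2 with the same restriction is therefore built from its values on
    A_2' xi, and membership is always proved through commutants. Its boundedness comes from |n T_z
    xi|^2 <= |n xi| |n T_w xi| with w = z^* z. After j iterations a constant depending on n survives
    only to the power 2^-j, so the limiting bound is uniform in n. The smallness of N does not
    restrict the words: the corner entry is multilinear in the entries of N, so shrinking them only
    multiplies it by a nonzero scalar. *)

Section InnerProduct.
Variables (R : realType) (H : hilbertType R).
Implicit Types (x y z : H) (c : R[i]).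

Lemma dotDl z x y : dot H (x + y) z = dot H x z + dot H y z.
Proof. exact: linearDl. Qed.

Lemma dotBl z x y : dot H (x - y) z = dot H x z - dot H y z.
Proof. exact: linearBl. Qed.

Lemma dot0l z : dot H 0 z = 0.
Proof. exact: linear0l. Qed.

Lemma dotZl c x y : dot H (c *: x) y = c * dot H x y.
Proof. exact: linearZl_LR. Qed.

Lemma dotC x y : dot H x y = (dot H y x)^*.
Proof. by rewrite hermC expr0 mul1r. Qed.

Lemma dotDr z x y : dot H z (x + y) = dot H z x + dot H z y.
Proof. exact: linearDr. Qed.

Lemma dotBr z x y : dot H z (x - y) = dot H z x - dot H z y.
Proof. exact: linearBr. Qed.

Lemma dot0r z : dot H z 0 = 0.
Proof. exact: linear0r. Qed.

Lemma dotZr c x y : dot H x (c *: y) = c^* * dot H x y.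
Proof. by rewrite dotC dotZl rmorphM/= [in RHS]dotC. Qed.

(** The norm of [H] takes values in [R[i]]; its real part makes infima and real arithmetic
    available. *)
Definition nrm x : R := complex.Re `|x|.

Lemma nrmE x : `|x| = (nrm x)%:C%C.
Proof. by rewrite RRe_real// ger0_real. Qed.

Lemma dotxx x : dot H x x = (nrm x ^+ 2)%:C%C.
Proof. by rewrite -dotE nrmE -rmorphXn. Qed.

Lemma nrm_ge0 x : 0 <= nrm x.
Proof. by rewrite -ler0c -nrmE. Qed.

Lemma nrm0 : nrm 0 = 0.
Proof. by rewrite /nrm normr0. Qed.

Lemma nrm_eq0 x : nrm x = 0 -> x = 0.
Proof. by move=> x0; apply/eqP; rewrite -normr_eq0 nrmE x0. Qed.

Lemma dot_eq0 x : dot H x x = 0 -> x = 0.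
Proof. by rewrite -dotE => /eqP; rewrite sqrf_eq0 normr_eq0 => /eqP. Qed.

Lemma nrmN x : nrm (- x) = nrm x.
Proof. by rewrite /nrm normrN. Qed.

Lemma nrmB x y : nrm (x - y) = nrm (y - x).
Proof. by rewrite -nrmN opprB. Qed.

Lemma nrmD x y : nrm (x + y) <= nrm x + nrm y.
Proof. by rewrite -lecR rmorphD/= -!nrmE ler_normD. Qed.

Lemma nrmZ c x : nrm (c *: x) = complex.Re `|c| * nrm x.
Proof.
apply: complexI; rewrite -nrmE normrZ rmorphM/= -nrmE; congr (_ * _).
Qed.

Lemma nrmZr (r : R) x : 0 <= r -> nrm (r%:C%C *: x) = r * nrm x.
Proof. by move=> r0; rewrite nrmZ ger0_norm// ler0c. Qed.

Lemma CauchySchwarz_dot x y : `|dot H x y| <= (nrm x * nrm y)%:C%C.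
Proof.
have [->|y0] := eqVneq y 0.
  by rewrite dot0r normr0 nrm0 mulr0.
have ny : (nrm y ^+ 2)%:C%C != 0 :> R[i].
  by rewrite -dotxx; apply: contra_neq y0 => /dot_eq0.
rewrite -(@ler_pXn2r _ 2) ?nnegrE ?normr_ge0 ?ler0c ?mulr_ge0 ?nrm_ge0//.
rewrite [leRHS](_ : _ = dot H x x * dot H y y); last first.
  by rewrite !dotxx -rmorphXn -rmorphM/= exprMn.
set d := dot H x y.
have /= : 0 <= dot H (x - (d / dot H y y) *: y) (x - (d / dot H y y) *: y).
  by rewrite dotxx ler0c sqr_ge0.
rewrite dotBl !dotBr !dotZl !dotZr rmorphM fmorphV/= (dotC y x) -/d -(dotC y y).
move: ny; rewrite -dotxx => ny.
have -> : d^* / dot H y y * dot H y y = d^* by rewrite divfK.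
rewrite [d / dot H y y * d^*]mulrAC -normCK subrr subr0 subr_ge0.
by rewrite mulrAC ler_pdivrMr ?[d^* * d]mulrC ?normCK// lt0r ny dotxx ler0c sqr_ge0.
Qed.

Lemma parallelogram x y :
  nrm (x + y) ^+ 2 + nrm (x - y) ^+ 2 = 2 * nrm x ^+ 2 + 2 * nrm y ^+ 2.
Proof.
suff : dot H (x + y) (x + y) + dot H (x - y) (x - y) =
    2%:R * dot H x x + 2%:R * dot H y y.
  by rewrite !dotxx -![2%:R](rmorph_nat (real_complex R)) -!rmorphM -!rmorphD
    => /complexI.
rewrite !(dotBl, dotBr, dotDl, dotDr).
move: (dot H x x) (dot H x y) (dot H y x) (dot H y y) => a b c d.
ring.
Qed.

Lemma closure_nrmP (A : set H) x :
  closure A x <-> forall e : R, 0 < e -> exists2 a, A a & nrm (x - a) < e.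
Proof.
split=> [cAx e e0|h B /nbhs_ballP[e /= e0 eB]].
  have [|a [Aa]] := cAx (ball x e%:C%C).
    by apply: nbhsx_ballx; rewrite ltcR.
  by rewrite -ball_normE/= nrmE ltcR => xa; exists a.
have [a Aa xa] : exists2 a, A a & nrm (x - a) < complex.Re e.
  by apply: h; move: e0; rewrite ltcE => /andP[].
exists a; split=> //; apply: eB; rewrite -ball_normE/= nrmE.
by rewrite -(@RRe_real _ e) ?ltcR// gtr0_real.
Qed.

Lemma complete_nrm (u : nat -> H) :
  (forall e : R, 0 < e ->
     exists N, forall m n, (N <= m)%N -> (N <= n)%N -> nrm (u m - u n) < e) ->
  exists l, forall e : R, 0 < e ->
     exists N, forall n, (N <= n)%N -> nrm (u n - l) < e.
Proof.
move=> cu; have /cauchy_cvgP/cvg_ex[l /= ul] : cauchy (u @ \oo).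
  apply/cauchy_ballP => e e0.
  have [|N hN] := cu (complex.Re e); first by move: e0; rewrite ltcE => /andP[].
  exists ([set z | exists2 m, (N <= m)%N & u m = z],
          [set z | exists2 m, (N <= m)%N & u m = z]) => /=.
    by split; exists N => // n /= Nn; exists n.
  move=> [z1 z2] [/= [m Nm <-] [n Nn <-]]; rewrite -ball_normE/= nrmE.
  by rewrite -(@RRe_real _ e) ?ltcR ?gtr0_real//; exact: hN.
exists l => e e0; move/cvgrPdist_lt : ul => /(_ e%:C%C).
rewrite ltcR => /(_ e0)[N _ hN]; exists N => n Nn; rewrite nrmB -ltcR -nrmE.
exact: hN.
Qed.

End InnerProduct.

Lemma natSinv_lt (R : realType) (e : R) : 0 < e ->
  exists N, forall n, (N <= n)%N -> n.+1%:R^-1 < e.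
Proof.
move=> e0; have [N _ hN] := near_infty_natSinv_lt (PosNum e0).
by exists N => n Nn; exact: hN.
Qed.

(** * Bounded linear maps: density and extension by continuity *)

Section LinearMaps.
Variables (R : realType) (H : hilbertType R).
Implicit Types (x y : H) (T : H -> H) (D : set H) (G : set (H * H)).

Lemma linD T x y : linear T -> T (x + y) = T x + T y.
Proof. by move=> lT; have := lT 1 x y; rewrite !scale1r. Qed.

Lemma lin0 T : linear T -> T 0 = 0.
Proof. by move=> lT; apply: (addIr (T 0)); rewrite -linD// !add0r. Qed.

Lemma linZ T (c : R[i]) x : linear T -> T (c *: x) = c *: T x.
Proof. by move=> lT; have := lT c x 0; rewrite (lin0 lT) !addr0. Qed.

Lemma linN T x : linear T -> T (- x) = - T x.
Proof. by move=> lT; rewrite -scaleN1r linZ// scaleN1r. Qed.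

Lemma linB T x y : linear T -> T (x - y) = T x - T y.
Proof. by move=> lT; rewrite linD// linN. Qed.

Lemma lin_sum T I (r : seq I) (F : I -> H) : linear T ->
  T (\sum_(i <- r) F i) = \sum_(i <- r) T (F i).
Proof.
by move=> lT; apply: (big_morph T) => [x y|]; [rewrite linD|rewrite lin0].
Qed.

Lemma bounded_opP T : bounded_op T <->
  linear T /\ exists2 C : R, 0 <= C & forall x, nrm (T x) <= C * nrm x.
Proof.
split=> -[lT]; last first.
  move=> [C C0 hC]; split=> // x; apply/cvgrPdist_lt => e e0.
  have re0 : 0 < complex.Re e by move: e0; rewrite ltcE => /andP[].
  apply/nbhs_ballP; exists ((complex.Re e / (C + 1))%:C%C) => /=.
    by rewrite ltcR divr_gt0// ltr_wpDl.
  move=> y; rewrite -ball_normE/= -linB// !nrmE ltcR => xy.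
  rewrite -(@RRe_real _ e) ?gtr0_real// ltcR (le_lt_trans (hC _))//.
  rewrite ltr_pdivlMr ?ltr_wpDl// in xy.
  by rewrite (le_lt_trans _ xy)// mulrC ler_wpM2l ?nrm_ge0// lerDl.
move=> /(_ 0) /cvgrPdist_lt/(_ 1 ltr01)/nbhs_ballP[d /= d0 hd]; split=> //.
have rd0 : 0 < complex.Re d by move: d0; rewrite ltcE => /andP[].
exists (2 / complex.Re d); first by rewrite divr_ge0// ltW.
move=> x; have [/nrm_eq0->|x0] := eqVneq (nrm x) 0.
  by rewrite lin0// nrm0 mulr0.
have {}x0 : 0 < nrm x by rewrite lt0r x0 nrm_ge0.
(* This multiple of [x] has norm half the radius [d], so it lies in the ball on which [T] stays
   below 1. *)
set r := complex.Re d / (2 * nrm x).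
have r0 : 0 < r by rewrite divr_gt0// mulr_gt0.
have : nrm (T (r%:C%C *: x)) < 1.
  rewrite -nrmN -[- T _]add0r -{1}(lin0 lT) -ltcR -nrmE; apply: hd.
  rewrite -ball_normE/= sub0r normrN nrmE nrmZr ?(ltW r0)//.
  rewrite -(@RRe_real _ d) ?gtr0_real// ltcR /r.
  rewrite invfM mulrA mulrVK ?unitfE ?gt_eqF//; lra.
rewrite linZ// nrmZr ?(ltW r0)// mulrC -ltr_pdivlMr// div1r => /ltW/le_trans.
by apply; rewrite /r invf_div mulrAC.
Qed.

Definition subspace D := D 0 /\ forall (c : R[i]) x y, D x -> D y -> D (c *: x + y).

Definition orthocomp D : set H := [set w | forall d, D d -> dot H d w = 0].

(** Density phrased through orthogonality, so that inner products alone can check it; [total_dense]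
    recovers approximation. *)
Definition total D := forall w, orthocomp D w -> w = 0.

Lemma nearest_orth (w d : H) :
  (forall c : R[i], nrm w <= nrm (w - c *: d)) -> dot H d w = 0.
Proof.
move=> h; have [->|d0] := eqVneq d 0; first by rewrite dot0l.
have nd : dot H d d != 0 by apply: contra_neq d0 => /dot_eq0.
(* The projection coefficient lowers the squared norm of [w] by |<w, d>|^2 / <d, d>, which
   minimality forces to be 0. *)
have := h (dot H w d / dot H d d).
rewrite -(@ler_pXn2r _ 2) ?nnegrE ?nrm_ge0// -lecR -!dotxx.
rewrite dotBl !dotBr !dotZl !dotZr rmorphM fmorphV/= (dotC d w) -(dotC d d).
set a := dot H w d.
rewrite divfK// [a / _ * _]mulrAC subrr subr0.
rewrite -subr_ge0 addrC addKr oppr_ge0 -mulrA mulrCA mulrA => h1.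
have : a * a^* / dot H d d = 0.
  apply/eqP; rewrite eq_le mulr_ge0 ?mul_conjC_ge0 ?invr_ge0 ?dotxx ?ler0c ?sqr_ge0//.
  by rewrite andbT -dotxx mulrC [a * _]mulrC mulrA.
move/eqP; rewrite mulf_eq0 invr_eq0 (negPf nd) orbF mul_conjC_eq0 => /eqP ->.
by rewrite rmorph0.
Qed.

(** A sequence in [D] minimizing the distance to [x] is Cauchy by the parallelogram law. Its limit
    [l] makes [x - l] orthogonal to [D], so x = l by totality. *)
Lemma total_dense D x (e : R) : subspace D -> total D -> 0 < e ->
  exists2 d, D d & nrm (x - d) < e.
Proof.
move=> [D0 Dl] tD e0.
have DB u v : D u -> D v -> D (u + v).
  by move=> Du Dv; rewrite -[u]scale1r; exact: Dl.
have DZ (c : R[i]) u : D u -> D (c *: u).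
  by move=> Du; rewrite -[_ *: _]addr0; exact: Dl.
pose S := [set nrm (x - d) | d in D]; pose m := inf S.
have S0 : has_inf S.
  split; first by exists (nrm (x - 0)); exists 0.
  by exists 0 => _ [d _ <-]; exact: nrm_ge0.
have mle d : D d -> m <= nrm (x - d).
  by move=> Dd; apply: ge_inf; [exact: S0.2|exists d].
have m0 : 0 <= m.
  by apply: lb_le_inf; [exact: S0.1|move=> _ [d _ <-]; exact: nrm_ge0].
have /choice[u hu] (n : nat) : exists d, D d /\ nrm (x - d) < m + n.+1%:R^-1.
  have n0 : 0 < n.+1%:R^-1 :> R by rewrite invr_gt0 ltr0n.
  by have [_ [d Dd <-] dm] := inf_adherent n0 S0; exists d.
have cu (a : R) : 0 < a -> exists N, forall k n, (N <= k)%N -> (N <= n)%N ->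
    nrm (u k - u n) < a.
  (* Both distances are below m + t and the midpoint is at distance at least m, so the squared gap
     is below 8mt + 4t^2, hence below t (8m + 5) because t <= 1. *)
  move=> a0; pose t := Num.min 1 (a ^+ 2 / (8 * m + 5)).
  have t0 : 0 < t by rewrite lt_min ltr01 divr_gt0 ?exprn_gt0//; lra.
  have t1 : t <= 1 by rewrite ge_min lexx.
  have t2 : t * (8 * m + 5) <= a ^+ 2.
    by rewrite -ler_pdivlMr ?ge_min ?lexx ?orbT//; lra.
  have [N hN] := natSinv_lt t0; exists N => k n Nk Nn.
  rewrite -(@ltr_pXn2r _ 2) ?nnegrE ?nrm_ge0 ?(ltW a0)//.
  have := parallelogram (x - u k) (x - u n).
  have -> : x - u k - (x - u n) = - (u k - u n).
    by rewrite opprB addrC addrA subrK opprB.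
  have -> : x - u k + (x - u n) =
      (2 : R)%:C%C *: (x - (2 : R)^-1%:C%C *: (u k + u n)).
    rewrite scalerBr scalerA -rmorphM divff// scale1r.
    by rewrite rmorph_nat scaler_nat mulr2n opprD addrACA.
  rewrite nrmN nrmZr// exprMn.
  have hm : m <= nrm (x - (2 : R)^-1%:C%C *: (u k + u n)).
    by apply: mle; apply: DZ; apply: DB; have [] := hu k; have [] := hu n.
  have hk : nrm (x - u k) < m + t by rewrite (lt_trans (hu k).2)// ltrD2l hN.
  have hn : nrm (x - u n) < m + t by rewrite (lt_trans (hu n).2)// ltrD2l hN.
  have := nrm_ge0 (x - u k); have := nrm_ge0 (x - u n).
  move: hm hk hn; move: (nrm (x - u k)) (nrm (x - u n)) (nrm _) (nrm _).
  move=> p q r s; nra.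
have [l hl] := complete_nrm cu.
have lm : nrm (x - l) <= m.
  apply/ler_addgt0Pr => a a0.
  have a20 : 0 < a / 2 by rewrite divr_gt0.
  have [N1 h1] := hl _ a20; have [N2 h2] := natSinv_lt a20.
  have := h1 _ (leq_maxl N1 N2); have := h2 _ (leq_maxr N1 N2).
  have := (hu (maxn N1 N2)).2.
  set n := maxn N1 N2; have := nrmD (x - u n) (u n - l).
  by rewrite addrA subrK; move: n.+1%:R^-1 => t; lra.
have ol : orthocomp D (x - l).
  move=> d Dd; apply: nearest_orth => c; apply: (le_trans lm).
  apply/ler_addgt0Pr => a a0; have [N hN] := hl _ a0.
  have := hN _ (leqnn N); have := mle _ (DB _ _ (hu N).1 (DZ c _ Dd)).
  have := nrmD (x - l - c *: d) (l - u N).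
  have -> : x - l - c *: d + (l - u N) = x - (u N + c *: d).
    by rewrite addrA [x - l - _ + _]addrAC subrK -addrA -opprD [c *: d + _]addrC.
  rewrite (nrmB l); lra.
have [N hN] := hl _ e0; exists (u N); first exact: (hu N).1.
have /eqP := tD _ ol; rewrite subr_eq0 => /eqP ->.
by rewrite nrmB; exact: hN.
Qed.

(** A relation is extended rather than a function: the bound makes it single-valued, so an
    assignment such as n xi |-> n T xi needs no separate proof that it is well defined. *)
Lemma bounded_extension G (C : R) :
  G (0, 0) ->
  (forall (c : R[i]) p q, G p -> G q -> G (c *: p.1 + q.1, c *: p.2 + q.2)) ->
  0 <= C -> (forall p, G p -> nrm p.2 <= C * nrm p.1) ->
  total [set p.1 | p in G] ->
  exists2 F, bounded_op F & forall p, G p -> F p.1 = p.2.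
Proof.
move=> G0 Gl C0 GC tG.
have sG : subspace [set p.1 | p in G].
  split=> [|c _ _ [p Gp <-] [q Gq <-]]; first by exists (0, 0).
  by exists (c *: p.1 + q.1, c *: p.2 + q.2) => //; exact: Gl.
(* [cl] is the closure of [G] in H x H and will be the graph of [F]. *)
pose cl x y := forall e : R, 0 < e ->
  exists2 p, G p & nrm (x - p.1) < e /\ nrm (y - p.2) < e.
have clG p : G p -> cl p.1 p.2.
  by move=> Gp e e0; exists p => //; rewrite !subrr nrm0.
have cll (c : R[i]) x y x' y' : cl x y -> cl x' y' ->
    cl (c *: x + x') (c *: y + y').
  move=> h h' e e0; pose k := complex.Re `|c|.
  have k0 : 0 <= k by rewrite -ler0c RRe_real// ger0_real.
  have d0 : 0 < e / (k + 1) by rewrite divr_gt0// ltr_wpDl.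
  have [p Gp [p1 p2]] := h _ d0; have [q Gq [q1 q2]] := h' _ d0.
  exists (c *: p.1 + q.1, c *: p.2 + q.2); first exact: Gl.
  have aux (a b a' b' : H) : nrm (a - b) < e / (k + 1) ->
      nrm (a' - b') < e / (k + 1) -> nrm (c *: a + a' - (c *: b + b')) < e.
    move=> ab ab'; rewrite opprD addrACA -scalerBr.
    rewrite (le_lt_trans (nrmD _ _))// nrmZ -/k.
    have -> : e = k * (e / (k + 1)) + e / (k + 1) by field; lra.
    by rewrite ler_ltD// ler_wpM2l// ltW.
  by split; exact: aux.
have clC x y : cl x y -> nrm y <= C * nrm x.
  move=> h; apply/ler_addgt0Pr => e e0.
  have d0 : 0 < e / (C + 1) by rewrite divr_gt0// ltr_wpDl.
  have [p Gp [p1 p2]] := h _ d0; have := GC _ Gp.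
  have := nrmD (y - p.2) p.2; have := nrmD (p.1 - x) x; rewrite !subrK nrmB.
  move=> h1 h2 h3; have : C * nrm p.1 <= C * (e / (C + 1)) + C * nrm x.
    by rewrite -mulrDr ler_wpM2l//; lra.
  have : e = C * (e / (C + 1)) + e / (C + 1) by field; lra.
  lra.
have ex x : exists y, cl x y.
  have /choice[u hu] (n : nat) : exists p, G p /\ nrm (x - p.1) < n.+1%:R^-1.
    have [|_ [p Gp <-] hp] := total_dense x sG tG (e := n.+1%:R^-1).
      by rewrite invr_gt0 ltr0n.
    by exists p.
  have cu (a : R) : 0 < a -> exists N, forall k n, (N <= k)%N -> (N <= n)%N ->
      nrm ((u k).2 - (u n).2) < a.
    move=> a0; have t0 : 0 < a / (2 * C + 1) by rewrite divr_gt0//; lra.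
    have [N hN] := natSinv_lt t0; exists N => k n Nk Nn.
    have := GC _ (Gl (-1) _ _ (hu n).1 (hu k).1) => /=.
    rewrite !scaleN1r ![- _ + _]addrC => /le_lt_trans; apply.
    have := nrmD ((u k).1 - x) (x - (u n).1); rewrite addrA subrK nrmB => h.
    have : C * nrm ((u k).1 - (u n).1) <= C * (2 * (a / (2 * C + 1))).
      rewrite ler_wpM2l//; have := (hu k).2; have := (hu n).2.
      have := hN _ Nk; have := hN _ Nn.
      by move: n.+1%:R^-1 k.+1%:R^-1 h => ? ?; lra.
    move=> /le_lt_trans; apply.
    rewrite [ltRHS](_ : a = (2 * C + 1) * (a / (2 * C + 1))); last by field; lra.
    by rewrite mulrA ltr_pM2r//; lra.
  have [l hl] := complete_nrm cu; exists l => e e0.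
  have [N1 h1] := hl _ e0; have [N2 h2] := natSinv_lt e0.
  exists (u (maxn N1 N2)); first exact: (hu _).1.
  split; last by rewrite nrmB h1// leq_maxl.
  by rewrite (lt_trans (hu _).2)// h2// leq_maxr.
have cl_uniq x y y' : cl x y -> cl x y' -> y = y'.
  move=> h h'; have /clC := cll (-1) _ _ _ _ h h'.
  rewrite !scaleN1r addNr nrm0 mulr0 => h0.
  apply/eqP; rewrite eq_sym -subr_eq0 addrC; apply/eqP/nrm_eq0.
  by apply/eqP; rewrite eq_le h0 nrm_ge0.
have [F hF] := choice ex; exists F; last first.
  by move=> p Gp; apply: (cl_uniq p.1) => //; exact: clG.
apply/bounded_opP; split; last by exists C => // x; exact: clC.
by move=> c x y; apply: (cl_uniq (c *: x + y)) => //; exact: cll.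
Qed.

End LinearMaps.

(** * Adjoints, partial isometries and projections *)

Section BoundedAlgebra.
Variables (R : realType) (H : hilbertType R).
Implicit Types (x y w : H) (S T : H -> H) (D : set H) (G : set (H * H)).

Lemma dot_inj x y : (forall z, dot H z x = dot H z y) -> x = y.
Proof.
move=> h; apply/eqP; rewrite -subr_eq0; apply/eqP/dot_eq0.
by rewrite dotBr h subrr.
Qed.

Lemma dot_injl x y : (forall z, dot H x z = dot H y z) -> x = y.
Proof. by move=> h; apply: dot_inj => z; rewrite dotC h -dotC. Qed.

Lemma dot_eq0C x y : dot H x y = 0 -> dot H y x = 0.
Proof. by move=> h; rewrite dotC h rmorph0. Qed.

Lemma bounded_op_id : bounded_op (id : H -> H).
Proof. by apply/bounded_opP; split=> //; exists 1 => // x; rewrite mul1r. Qed.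

Lemma bounded_op_comp S T : bounded_op S -> bounded_op T -> bounded_op (S \o T).
Proof.
move=> /bounded_opP[lS [C C0 hC]] /bounded_opP[lT [K K0 hK]].
apply/bounded_opP; split; first by move=> c x y /=; rewrite lT lS.
exists (C * K) => [|x /=]; first exact: mulr_ge0.
by rewrite (le_trans (hC _))// -mulrA ler_wpM2l.
Qed.

Lemma bounded_op_lincomb (c : R[i]) S T :
  bounded_op S -> bounded_op T -> bounded_op (c *: S + T).
Proof.
move=> /bounded_opP[lS [C C0 hC]] /bounded_opP[lT [K K0 hK]].
apply/bounded_opP; split=> [a x y|].
  rewrite !fctE lS lT !scalerDr !scalerA [c * a]mulrC -!addrA; congr (_ + _).
  by rewrite addrCA.
have n0 : 0 <= complex.Re `|c| by rewrite -ler0c RRe_real// ger0_real.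
exists (complex.Re `|c| * C + K); first by rewrite addr_ge0// mulr_ge0.
move=> x; rewrite !fctE (le_trans (nrmD _ _))// nrmZ mulrDl -mulrA lerD//.
by rewrite ler_wpM2l.
Qed.

Lemma bounded_op_scalar (c : R[i]) : bounded_op (@scalar_op R H c).
Proof.
apply/bounded_opP; split=> [a x y|].
  by rewrite /scalar_op scalerDr !scalerA mulrC.
exists (complex.Re `|c|) => [|x]; last by rewrite nrmZ.
by rewrite -ler0c RRe_real// ger0_real.
Qed.

(** If the kernel of the functional x |-> <T x, y> is total, the functional vanishes by continuity;
    otherwise a nonzero vector orthogonal to the kernel has a multiple that represents it. *)
Lemma riesz T y : bounded_op T -> exists z, forall x, dot H (T x) y = dot H x z.
Proof.
move=> /bounded_opP[lT [C C0 hC]].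
pose D := [set x | dot H (T x) y = 0].
have sD : subspace D.
  split=> [|c u v]; rewrite /D/= ?(lin0 lT) ?dot0l// lT dotDl dotZl => -> ->.
  by rewrite mulr0 addr0.
have [tD|] := pselect (total D).
  exists 0 => x; rewrite dot0r; apply/eqP; rewrite -normr_le0.
  have -> : `|dot H (T x) y| = (complex.Re `|dot H (T x) y|)%:C%C.
    by rewrite RRe_real// ger0_real.
  rewrite (_ : 0 = 0%:C%C)// lecR; apply/ler_addgt0Pr => e e0; rewrite add0r.
  pose K := C * nrm y + 1.
  have K0 : 0 < K by rewrite ltr_wpDl// mulr_ge0// nrm_ge0.
  have [d Dd xd] := total_dense x sD tD (divr_gt0 e0 K0).
  rewrite -lecR RRe_real ?ger0_real//.
  have -> : dot H (T x) y = dot H (T (x - d)) y.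
    by rewrite (linB _ _ lT) dotBl Dd subr0.
  rewrite (le_trans (CauchySchwarz_dot _ _))// lecR.
  rewrite (le_trans (ler_wpM2r (nrm_ge0 _) (hC _)))//.
  rewrite mulrAC (le_trans (ler_wpM2l _ (ltW xd))) ?mulr_ge0 ?nrm_ge0//.
  by rewrite mulrCA ger_pMr// ler_pdivrMr// mul1r lerDl.
move=> /existsNP[w /not_implyP[ow w0]].
have fw : dot H (T w) y != 0.
  by apply/eqP => fw; apply: w0; apply: dot_eq0; apply: ow.
have nw : dot H w w != 0 by apply/eqP => /dot_eq0.
exists ((dot H (T w) y / dot H w w)^* *: w) => x.
rewrite dotZr conjCK.
have : dot H (x - (dot H (T x) y / dot H (T w) y) *: w) w = 0.
  by apply: ow; rewrite /D/= (linB _ _ lT) (linZ _ _ lT) dotBl dotZl divfK// subrr.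
rewrite dotBl dotZl => /eqP; rewrite subr_eq0 => /eqP ->.
by rewrite mulrACA mulVf// mulr1 mulrC divfK.
Qed.

Lemma adj_spec T : bounded_op T ->
  bounded_op (adj T) /\ forall x y, dot H (T x) y = dot H x (adj T y).
Proof.
move=> bT; suff [S hS] : exists S : H -> H,
    bounded_op S /\ forall x y, dot H (T x) y = dot H x (S y).
  exact: (@xgetI _ 0 [set S : H -> H |
    bounded_op S /\ forall x y, dot H (T x) y = dot H x (S y)] S hS).
have [S hS] := choice (fun y => riesz y bT); exists S; split=> //.
case/bounded_opP: bT => lT [C C0 hC].
apply/bounded_opP; split=> [c u v|].
  apply: dot_inj => z; rewrite -hS !dotDr !dotZr -!hS//.
(* The bound of [T] serves for [S]: |S x|^2 = <T S x, x> <= C |S x| |x|, and one factor |S x|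
   cancels. *)
exists C => // x; have [->|Sx0] := eqVneq (nrm (S x)) 0.
  by rewrite mulr_ge0// nrm_ge0.
have {}Sx0 : 0 < nrm (S x) by rewrite lt0r Sx0 nrm_ge0.
rewrite -(@ler_pM2l _ (nrm (S x)))// -expr2 -lecR -dotxx -hS.
have := CauchySchwarz_dot (T (S x)) x; rewrite hS dotxx ger0_norm ?ler0c ?sqr_ge0//.
move=> /le_trans; apply; rewrite lecR.
by rewrite mulrCA mulrA ler_wpM2r ?nrm_ge0.
Qed.

Lemma adj_bounded T : bounded_op T -> bounded_op (adj T).
Proof. by move=> /adj_spec[]. Qed.

Lemma dot_adjr T x y : bounded_op T -> dot H (T x) y = dot H x (adj T y).
Proof. by move=> /adj_spec[_]; exact. Qed.

Lemma dot_adjl T x y : bounded_op T -> dot H x (T y) = dot H (adj T x) y.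
Proof. by move=> bT; rewrite dotC dot_adjr// -dotC. Qed.

Lemma adj_unique S T : bounded_op T ->
  (forall x y, dot H (T x) y = dot H x (S y)) -> adj T = S.
Proof.
by move=> bT h; apply/funext => y; apply: dot_inj => z; rewrite -dot_adjr// h.
Qed.

Lemma adjK T : bounded_op T -> adj (adj T) = T.
Proof.
move=> bT; apply: adj_unique; first exact: adj_bounded.
by move=> x y; rewrite -dot_adjl.
Qed.

Lemma adj_comp S T : bounded_op S -> bounded_op T ->
  adj (S \o T) = adj T \o adj S.
Proof.
move=> bS bT; apply: adj_unique; first exact: bounded_op_comp.
by move=> x y /=; rewrite !dot_adjr.
Qed.

Lemma adj_scalar (c : R[i]) : adj (@scalar_op R H c) = scalar_op c^*.
Proof.
apply: adj_unique; first exact: bounded_op_scalar.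
by move=> x y; rewrite /scalar_op dotZl dotZr conjCK.
Qed.

Lemma eq_on_total D S T : total D -> bounded_op S -> bounded_op T ->
  (forall d, D d -> S d = T d) -> S = T.
Proof.
move=> tD bS bT h; apply/funext => x; apply: dot_injl => z.
rewrite !dot_adjr//.
suff -> : adj S z = adj T z by [].
apply/eqP; rewrite -subr_eq0; apply/eqP.
by apply: tD => d Dd; rewrite dotBr -!dot_adjr// h// subrr.
Qed.

Lemma eq_on_closure D S T x : bounded_op S -> bounded_op T ->
  (forall d, D d -> S d = T d) -> closure D x -> S x = T x.
Proof.
move=> bS bT h /closure_nrmP cx.
have /bounded_opP[lF [C C0 hC]] := bounded_op_lincomb (-1) bS bT.
apply/eqP; rewrite eq_sym -subr_eq0 addrC -scaleN1r; apply/eqP/nrm_eq0.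
apply/eqP; rewrite eq_le nrm_ge0 andbT; apply/ler_addgt0Pr => e e0.
have [|d Dd xd] := cx (e / (C + 1)); first by rewrite divr_gt0// ltr_wpDl.
have -> : (-1 *: S x + T x : H) = (-1 *: S + T : H -> H) (x - d).
  have Fd : (-1 *: S + T : H -> H) d = 0.
    by rewrite -[LHS]/(-1 *: S d + T d) h// scaleN1r addNr.
  by rewrite (linB _ _ lF) Fd subr0.
rewrite (le_trans (hC _))// (le_trans (ler_wpM2l C0 (ltW xd)))// add0r.
by rewrite mulrCA ger_pMr// ler_pdivrMr ?ltr_wpDl// mul1r lerDl.
Qed.

Lemma nrm_pythagoras x y : dot H x y = 0 -> nrm x <= nrm (x + y).
Proof.
move=> xy; rewrite -(@ler_pXn2r _ 2) ?nnegrE ?nrm_ge0// -lecR -!dotxx.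
rewrite dotDl !dotDr xy (dot_eq0C xy) addr0 add0r lerDl.
by rewrite dotxx ler0c sqr_ge0.
Qed.

Lemma orthocomp_subspace D : subspace (orthocomp D).
Proof.
split=> [d _|c x y Dx Dy d Dd]; first by rewrite dot0r.
by rewrite dotDr dotZr Dx// Dy// mulr0 addr0.
Qed.

Lemma total_orthocomp D : D 0 -> total [set d + k | d in D & k in orthocomp D].
Proof.
move=> D0 w ow; have Dw : orthocomp D w.
  move=> d Dd; apply: ow; exists d => //; exists 0; last exact: addr0.
  by case: (orthocomp_subspace D).
by apply: dot_eq0; apply: ow; exists 0 => //; exists w; rewrite ?add0r.
Qed.

(** The isometric relation is extended by 0 on the orthocomplement of its domain. A subspace plus
    its orthocomplement is total even when not closed, so Pythagoras gives the bound 1 and the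
    adjoint is determined by testing on that sum. *)
Lemma partial_isometry G :
  G (0, 0) ->
  (forall (c : R[i]) p q, G p -> G q -> G (c *: p.1 + q.1, c *: p.2 + q.2)) ->
  (forall p q, G p -> G q -> dot H p.2 q.2 = dot H p.1 q.1) ->
  exists U, [/\ bounded_op U,
    forall p, G p -> U p.1 = p.2,
    forall k, orthocomp [set p.1 | p in G] k -> U k = 0,
    forall p, G p -> adj U p.2 = p.1 &
    forall k, orthocomp [set p.2 | p in G] k -> adj U k = 0].
Proof.
move=> G0 Gl Gd.
set D1 := [set p.1 | p in G]; set D2 := [set p.2 | p in G].
have tD : total [set d + k | d in D1 & k in orthocomp D1].
  by apply: total_orthocomp; exists (0, 0).
pose G' := [set r : H * H | exists2 p, G p &
  exists2 k, orthocomp D1 k & r = (p.1 + k, p.2)].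
have G'l c p q : G' p -> G' q -> G' (c *: p.1 + q.1, c *: p.2 + q.2).
  move=> [p' Gp [k k0 ->]] [q' Gq [l l0 ->]].
  exists (c *: p'.1 + q'.1, c *: p'.2 + q'.2); first exact: Gl.
  exists (c *: k + l); first by apply: (orthocomp_subspace D1).2.
  by rewrite /= scalerDr addrACA.
have [|||U bU hU] := @bounded_extension _ _ G' 1 _ G'l ler01.
- exists (0, 0) => //; exists 0; last by rewrite /= addr0.
  by case: (orthocomp_subspace D1).
- move=> _ [p Gp [k k0 ->]]; rewrite mul1r /=.
  have -> : nrm p.2 = nrm p.1.
    apply/eqP; rewrite -(@eqrXn2 _ 2) ?nrm_ge0//; apply/eqP/complexI.
    by rewrite -!dotxx; exact: Gd.
  by apply: nrm_pythagoras; apply: k0; exists p.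
- move=> w ow; apply: tD => _ [_ [p Gp <-] [k k0 <-]]; apply: ow.
  by exists (p.1 + k, p.2) => //; exists p => //; exists k.
have U1 p : G p -> U p.1 = p.2.
  move=> Gp; apply: (hU p); exists p => //; exists 0; last first.
    by rewrite addr0; case: p {Gp}.
  by case: (orthocomp_subspace D1).
have U0 k : orthocomp D1 k -> U k = 0.
  by move=> k0; apply: (hU (k, 0)); exists (0, 0) => //; exists k; rewrite ?add0r.
exists U; split=> // [p Gp|k k0].
- apply/eqP; rewrite -subr_eq0; apply/eqP/tD => _ [_ [q Gq <-] [k k0 <-]].
  rewrite dotBr -dot_adjr// (linD _ _ bU.1) (U0 k)// addr0 U1// Gd// dotDl.
  by rewrite (@dot_eq0C _ _ (k0 _ _)) ?addr0 ?subrr//; exists p.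
- apply: tD => _ [_ [q Gq <-] [l l0 <-]].
  rewrite -dot_adjr// (linD _ _ bU.1) (U0 l)// addr0 U1//.
  by apply: k0; exists q.
Qed.

Lemma projection_closure D S x : subspace D -> bounded_op S ->
  (forall d, D d -> S d = d) -> (forall k, orthocomp D k -> S k = 0) ->
  closure D x <-> S x = x.
Proof.
move=> sD bS SD SD0; split=> [|Sx].
  by apply: eq_on_closure => //; exact: bounded_op_id.
case/bounded_opP: (bS) => lS [C C0 hC]; apply/closure_nrmP => e e0.
pose D' := [set d + k | d in D & k in orthocomp D].
have sD' : subspace D'.
  split=> [|c _ _ [d Dd [k k0 <-]] [d' Dd' [k' k0' <-]]].
    exists 0; first exact: sD.1.
    by exists 0; rewrite ?addr0//; case: (orthocomp_subspace D).
  exists (c *: d + d'); first exact: sD.2.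
  exists (c *: k + k'); first by apply: (orthocomp_subspace D).2.
  by rewrite scalerDr addrACA.
have c0 : 0 < e / (C + 1) by rewrite divr_gt0// ltr_wpDl.
have [_ [d Dd [k k0 <-]] xd] := total_dense x sD' (total_orthocomp sD.1) c0.
(* [S] fixes [x] and [d] and kills [k], so [x - d] inherits the smallness of x - (d + k). *)
exists d => //; have -> : x - d = S (x - (d + k)).
  by rewrite (linB _ _ lS) (linD _ _ lS) Sx SD// SD0// addr0.
rewrite (le_lt_trans (hC _))// (le_lt_trans (ler_wpM2l C0 (ltW xd)))//.
by rewrite mulrCA gtr_pMr// ltr_pdivrMr ?ltr_wpDl// mul1r ltrDl.
Qed.

End BoundedAlgebra.

(** * Commutants and resolvents of self-adjoint operators *)

Section Commutants.
Variables (R : realType) (H : hilbertType R).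
Implicit Types (x y : H) (S T : H -> H) (M A : set (H -> H)).

Definition star_closed M := M `<=` @bounded_op R H /\ forall T, M T -> M (adj T).

Lemma commutantE M S T x : commutant M T -> M S -> T (S x) = S (T x).
Proof. by move=> [_ h] /h /(congr1 (fun f => f x)). Qed.

Lemma commutantI M T : bounded_op T ->
  (forall S x, M S -> T (S x) = S (T x)) -> commutant M T.
Proof. by move=> bT h; split=> // S MS; apply/funext => x; exact: h. Qed.

Lemma commutant_id M : commutant M id.
Proof. by apply: commutantI => //; exact: bounded_op_id. Qed.

Lemma commutant_comp M S T :
  commutant M S -> commutant M T -> commutant M (S \o T).
Proof.
move=> cS cT; apply: commutantI; first exact: bounded_op_comp cS.1 cT.1.
by move=> F x MF /=; rewrite (commutantE _ cT)// (commutantE _ cS).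
Qed.

Lemma commutant_lincomb M (c : R[i]) S T : M `<=` @bounded_op R H ->
  commutant M S -> commutant M T -> commutant M (c *: S + T).
Proof.
move=> Mb cS cT; apply: commutantI; first exact: bounded_op_lincomb cS.1 cT.1.
move=> F x MF; have lF := (Mb _ MF).1.
rewrite -[LHS]/(c *: S (F x) + T (F x)) (commutantE _ cS)// (commutantE _ cT)//.
by rewrite -lF.
Qed.

Lemma commutant_scalar M (c : R[i]) : M `<=` @bounded_op R H ->
  commutant M (scalar_op c).
Proof.
move=> Mb; apply: commutantI; first exact: bounded_op_scalar.
by move=> F x MF; rewrite /scalar_op (linZ _ _ (Mb _ MF).1).
Qed.

Lemma commutant_bounded M : commutant M `<=` @bounded_op R H.
Proof. by move=> T []. Qed.

Lemma commutant_adj M T : star_closed M -> commutant M T -> commutant M (adj T).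
Proof.
move=> [Mb Ms] cT; apply: commutantI; first exact: adj_bounded cT.1.
move=> S x MS; have bS := Mb _ MS.
apply: dot_inj => z; rewrite -(dot_adjr _ _ cT.1) !dot_adjl//; last first.
  exact: adj_bounded cT.1.
by rewrite (adjK cT.1) (commutantE _ cT)//; exact: Ms.
Qed.

Lemma commutant_star M : star_closed M -> star_closed (commutant M).
Proof.
by move=> sM; split; [exact: commutant_bounded|move=> T; exact: commutant_adj].
Qed.

Lemma commutant_sub M A : M `<=` A -> commutant A `<=` commutant M.
Proof. by move=> MA T [bT h]; split=> // S /MA; exact: h. Qed.

Lemma sub_bicommutant M : M `<=` @bounded_op R H ->
  M `<=` commutant (commutant M).
Proof.
move=> Mb T MT; apply: commutantI; first exact: Mb.
by move=> S x cS; rewrite (commutantE _ cS).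
Qed.

(** M' = M''' makes M'' a von Neumann algebra, and any N = N'' that contains M contains M''. *)
Lemma generated_vN_bicommutant M : star_closed M ->
  generated_vN M = commutant (commutant M).
Proof.
move=> sM; apply/seteqP; split=> [T|T cT A [[Ab As Acc] MA]].
  apply; split; last exact: sub_bicommutant sM.1.
  split; first exact: commutant_bounded.
  - by move=> S; apply: commutant_adj; exact: commutant_star.
  - apply/seteqP; split; last exact/sub_bicommutant/commutant_bounded.
    exact/commutant_sub/sub_bicommutant/commutant_bounded.
by rewrite -Acc; move: T cT; apply/commutant_sub/commutant_sub.
Qed.

Lemma vN_star A : von_neumann A -> star_closed A.
Proof. by case. Qed.

Lemma vN_id A : von_neumann A -> A id.
Proof. by case=> _ _ <-; exact: commutant_id. Qed.

Lemma vN_comp A S T : von_neumann A -> A S -> A T -> A (S \o T).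
Proof. by case=> _ _ <-; exact: commutant_comp. Qed.

Lemma vN_lincomb A (c : R[i]) S T : von_neumann A -> A S -> A T -> A (c *: S + T).
Proof. by case=> _ _ <-; apply: commutant_lincomb; exact: commutant_bounded. Qed.

Lemma vN_scalar A (c : R[i]) : von_neumann A -> A (scalar_op c).
Proof. by case=> _ _ <-; apply: commutant_scalar; exact: commutant_bounded. Qed.

End Commutants.

(** [true] stands for -i, so that the parity of an index is its sign on the diagonal. *)
Definition signed_i (R : realType) (s : bool) : R[i] := if s then - 'i else 'i.

Section SignedI.
Variables (R : realType) (s : bool).

Lemma conj_signed_i : (signed_i R s)^* = - signed_i R s.
Proof. by case: s; rewrite /= ?rmorphN/= conjCi. Qed.

Lemma signed_i_norm : signed_i R s * (signed_i R s)^* = 1.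
Proof.
by rewrite conj_signed_i; case: s => /=; rewrite ?opprK ?mulrN ?mulNr -expr2 sqrCi opprK.
Qed.

Lemma signed_iN : - signed_i R s = signed_i R (~~ s).
Proof. by case: s; rewrite //= opprK. Qed.

End SignedI.

(** * Inverses of a + i and a - i for self-adjoint a *)

Section ShiftInverse.
Variables (R : realType) (H : hilbertType R).
Implicit Types (x y : H) (S T r u h : H -> H) (A M : set (H -> H)).
Implicit Types (a : set (H * H)) (z : R[i]).

Lemma adjoint_graph_lincomb a (c : R[i]) p q : adjoint_graph a = a ->
  a p -> a q -> a (c *: p.1 + q.1, c *: p.2 + q.2).
Proof.
move=> sa; rewrite -[in a p]sa -[in a q]sa -[in X in _ -> _ -> X]sa.
move=> hp hq s as_ /=; rewrite !dotDr !dotZr; congr (_ * _ + _).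
  exact: hp.
exact: hq.
Qed.

Lemma adjoint_graph_dot a p q : adjoint_graph a = a ->
  a p -> a q -> dot H p.2 q.1 = dot H p.1 q.2.
Proof. by move=> sa ap; rewrite -sa; apply. Qed.

(** A vector w orthogonal to the range of a + z is in the domain of the adjoint, that is of a, with
    a w = z w; symmetry then gives z <w, w> = - z <w, w>. *)
Lemma shift_total a z : adjoint_graph a = a -> z^* = - z -> z != 0 ->
  total [set p.2 + z *: p.1 | p in a].
Proof.
move=> sa zc z0 w ow; have aw : a (w, z *: w).
  rewrite -sa => q aq; have /eqP : dot H (q.2 + z *: q.1) w = 0.
    by apply: ow; exists q.
  by rewrite /= dotDl dotZl addr_eq0 => /eqP ->; rewrite dotZr zc mulNr.
apply: dot_eq0; have := adjoint_graph_dot sa aw aw; rewrite /= dotZl dotZr zc.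
move=> /eqP; rewrite mulNr -addr_eq0 -mulr2n mulrn_eq0 /= mulf_eq0.
by rewrite (negPf z0) => /eqP.
Qed.

Lemma shift_inverse_ex a z : adjoint_graph a = a -> z^* = - z -> z * z^* = 1 ->
  exists r, shift_inverse a z r.
Proof.
move=> sa zc zz.
have z0 : z != 0 by apply: contra_eq_neq zz => ->; rewrite mul0r eq_sym oner_eq0.
have a0 : a (0, 0) by rewrite -sa => q _; rewrite !dot0r.
have tG := shift_total sa zc z0.
(* The graph of the inverse of a + z. It is contractive: z is imaginary of modulus 1, so |a x + z
   x|^2 = |a x|^2 + |x|^2. *)
pose G := [set (p.2 + z *: p.1, p.1) | p in a].
have [|||||r br hr] := @bounded_extension _ _ G 1.
- by exists (0, 0); rewrite //= scaler0 addr0.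
- move=> c _ _ [p ap <-] [q aq <-].
  exists (c *: p.1 + q.1, c *: p.2 + q.2); first exact: adjoint_graph_lincomb.
  by rewrite /= !scalerDr !scalerA [z * c]mulrC addrACA.
- exact: ler01.
- move=> _ [p ap <-] /=; rewrite mul1r.
  rewrite -(@ler_pXn2r _ 2) ?nnegrE ?nrm_ge0// -lecR -!dotxx.
  rewrite dotDl !dotDr !dotZl !dotZr (adjoint_graph_dot sa ap ap) mulrA zz mul1r.
  by rewrite zc mulNr addrA subrK lerDr dotxx ler0c sqr_ge0.
- move=> w ow; apply: tG => _ [p ap <-]; apply: ow.
  by exists (p.2 + z *: p.1, p.1) => //; exists p.
have hr' x y : a (x, y) -> r (y + z *: x) = x.
  by move=> axy; apply: (hr (y + z *: x, x)); exists (x, y).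
exists r; split=> // u; rewrite -sa => q aq /=.
(* The condition that (r u, u - z r u) lies in the adjoint graph, moved off [u]; it is checked on
   the total range of a + z. *)
have : adj r q.2 - q.1 + z^* *: adj r q.1 = 0.
  apply: tG => _ [[x y] axy <-]; apply: dot_eq0C.
  rewrite dotDl dotBl dotZl -!dot_adjl// hr'//= dotDr dotZr.
  by rewrite -(adjoint_graph_dot sa aq axy)/= opprD addrA subrr sub0r addNr.
move=> /(congr1 (fun v => dot H v u)); rewrite dot0l dotDl dotBl dotZl -!dot_adjl//.
move=> /eqP; rewrite -addrA addr_eq0 opprD opprK => /eqP ->.
by rewrite dotBr dotZr.
Qed.

Lemma shift_inverse_uniq a z r r' :
  shift_inverse a z r -> shift_inverse a z r' -> r = r'.
Proof.
move=> [_ _ ar] [_ r'K _]; apply/funext => u.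
by have := r'K _ _ (ar u); rewrite subrK.
Qed.

Lemma shift_inverse_adj a z r r' : adjoint_graph a = a -> z^* = - z ->
  shift_inverse a z r -> shift_inverse a (- z) r' -> adj r = r'.
Proof.
move=> sa zc [br _ ar] [_ _ ar']; apply: adj_unique => // x y.
have := adjoint_graph_dot sa (ar x) (ar' y).
rewrite /= dotBl dotBr !dotZl !dotZr rmorphN/= zc opprK => /eqP.
by rewrite -subr_eq opprK subrK eq_sym => /eqP.
Qed.

Lemma shift_inverse_commute a z r u : shift_inverse a z r -> linear u ->
  (forall p, a p -> a (u p.1, u p.2)) -> r \o u = u \o r.
Proof.
move=> [_ rK ar] lu ua; apply/funext => w /=.
have := rK _ _ (ua _ (ar w)); rewrite /= (linB _ _ lu) (linZ _ _ lu) subrK.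
by [].
Qed.

Lemma graph_selfadjoint h : (forall x y, dot H (h x) y = dot H x (h y)) ->
  adjoint_graph [set p | p.2 = h p.1] = [set p | p.2 = h p.1].
Proof.
move=> sh; apply/seteqP; split=> p /=.
  move=> hp; apply: dot_inj => v; rewrite -sh.
  by rewrite -(hp (v, h v)).
by move=> ph q /= ->; rewrite ph.
Qed.

(* Through the Cayley transform of a self-adjoint element, the unitaries of a
   von Neumann algebra determine its commutant. *)
Lemma commute_unitaries_sa N T h : von_neumann N -> bounded_op T ->
  (forall u, N u -> unitary_op u -> T \o u = u \o T) ->
  N h -> (forall x y, dot H (h x) y = dot H x (h y)) -> T \o h = h \o T.
Proof.
move=> vN bT Tu Nh sh; have sg := graph_selfadjoint sh.
have [Nb _ Ncc] := vN; have bh := Nb _ Nh.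
have [r hr] := shift_inverse_ex sg (conj_signed_i R false) (signed_i_norm R false).
have [r' hr'] := shift_inverse_ex sg (conj_signed_i R true) (signed_i_norm R true).
have rr' := shift_inverse_adj sg (conj_signed_i R false) hr hr'.
move: hr hr'; rewrite /signed_i => -[br rK hr] [br' r'K hr'].
have lr := br.1.
have Nr : N r.
  rewrite -Ncc; apply: commutantI => // S x cS.
  suff : r \o S = S \o r by move/(congr1 (fun f => f x)).
  apply: (@shift_inverse_commute [set p | p.2 = h p.1] 'i).
  - by split.
  - exact: (cS.1).1.
  - by move=> p /= ->; rewrite (commutantE _ cS).
(* [u] is the Cayley transform (h - i)(h + i)^-1, written as 1 - 2i (h + i)^-1. Commuting with [u]
   gives commuting with [r], hence with [h]. *)
pose u : H -> H := (- (2 * 'i)) *: r + id.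
pose u' : H -> H := (2 * 'i) *: r' + id.
have uE x : u x = - (2 * 'i) *: r x + x by [].
have u'E x : u' x = (2 * 'i) *: r' x + x by [].
have bu : bounded_op u by apply: bounded_op_lincomb => //; exact: bounded_op_id.
have au : adj u = u'.
  apply: adj_unique => // x y; rewrite uE u'E dotDl dotDr dotZl dotZr.
  by rewrite dot_adjr// rr' rmorphM/= conjCi rmorph_nat mulrN.
have i2 : (2 * 'i : R[i]) != 0 by rewrite mulf_neq0// ?pnatr_eq0// neq0Ci.
have uu' : unitary_op u.
  have uK x : u (h x + 'i *: x) = h x - 'i *: x.
    rewrite uE rK// scaleNr addrC -addrA; congr (_ + _).
    by rewrite -scalerBl -scaleNr; congr (_ *: _); ring.
  have u'K x : u' (h x - 'i *: x) = h x + 'i *: x.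
    rewrite u'E -scaleNr r'K// addrC -addrA; congr (_ + _).
    by rewrite -scalerDl; congr (_ *: _); ring.
  split; apply/funext => x; rewrite au /=.
  - by have := hr x; move=> /= e; rewrite -{1}[x](subrK ('i *: r x)) e uK u'K -e subrK.
  - have /= e := hr' x; rewrite -{1}[x](subrK (- 'i *: r' x)) e scaleNr u'K uK.
    by rewrite -scaleNr -e subrK.
have Tru : T \o u = u \o T by apply: Tu => //; apply: vN_lincomb => //; exact: vN_id.
have Tr x : T (r x) = r (T x).
  have := congr1 (fun f => f x) Tru; rewrite /= !uE bT.1 => /addIr.
  by move=> /(scalerI _); apply; rewrite oppr_eq0.
apply/funext => x /=.
have /(congr1 (fun v => h v + 'i *: v)) := Tr (h x + 'i *: x).
rewrite rK//; have /= <- := hr (T (h x + 'i *: x)).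
by rewrite subrK (linD _ _ bT.1) (linZ _ _ bT.1) => /addIr.
Qed.

(** Affiliation speaks only of unitaries of the commutant. The passage to the whole algebra splits S
    into the self-adjoint combinations S + S^* and i S - i S^* of [N]. *)
Lemma commute_unitaries N T : von_neumann N -> bounded_op T ->
  (forall u, N u -> unitary_op u -> T \o u = u \o T) -> commutant N T.
Proof.
move=> vN bT Tu; apply: commutantI => // S x NS.
have bS := (vN_star vN).1 _ NS; have Na := (vN_star vN).2 _ NS.
have ba := adj_bounded bS.
have csa := commute_unitaries_sa vN bT Tu.
pose h1 : H -> H := 1 *: S + adj S.
have h1E v : h1 v = S v + adj S v by rewrite -[S v]scale1r.
pose k2 : H -> H := (- 'i) *: adj S + scalar_op 0.
pose h3 : H -> H := 'i *: S + k2.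
have h3E v : h3 v = 'i *: S v - 'i *: adj S v.
  by rewrite -scaleNr -[RHS]addr0 -addrA -(scale0r v).
have Nh1 : N h1 by exact: vN_lincomb.
have Nh3 : N h3.
  apply: vN_lincomb => //; apply: vN_lincomb => //; exact: vN_scalar.
have /(congr1 (fun f => f x)) /= T1 : T \o h1 = h1 \o T.
  apply: csa => // u v; rewrite !h1E dotDl dotDr addrC.
  by rewrite -[dot H (adj S u) v]dot_adjl// [dot H (S u) v]dot_adjr.
have /(congr1 (fun f => f x)) /= T3 : T \o h3 = h3 \o T.
  apply: csa => // u v; rewrite !h3E dotBl dotBr !dotZl !dotZr conjCi.
  rewrite -[dot H (adj S u) v]dot_adjl// [dot H (S u) v]dot_adjr//.
  by rewrite !mulNr opprK addrC.
move: T1 T3; rewrite !h1E !h3E (linD _ _ bT.1) (linB _ _ bT.1) !(linZ _ _ bT.1).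
move=> T1; rewrite -!scalerBr => /(scalerI (neq0Ci _)) T3.
have : 2%:R *: T (S x) = 2%:R *: S (T x) :> H.
  have := congr2 +%R T1 T3; rewrite addrACA [T (adj S x) - _]subrr addr0.
  by rewrite addrACA subrr addr0 !scaler_nat !mulr2n.
by move=> /(scalerI _); apply; rewrite pnatr_eq0.
Qed.

Lemma affiliated_shift_inverse A a s r : von_neumann A -> affiliated_sa A a ->
  shift_inverse a (signed_i R s) r -> A r.
Proof.
move=> vA [[_ aff] sa] hr; have [br _ _] := hr; have [_ _ <-] := vA.
apply: commute_unitaries => //.
  have sA := vN_star vA.
  split; first exact: commutant_bounded.
  - by move=> T; exact: commutant_adj.
  - by have [_ _ ->] := vA.
move=> u cu uu; apply: (shift_inverse_commute hr); first exact: (cu.1).1.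
by move=> p ap; rewrite -(aff _ cu uu); exists p.
Qed.

End ShiftInverse.

(** * Words as entries of resolvents of matrices *)

Section Words.
Variables (R : realType) (H : hilbertType R).
Implicit Types (r : bool -> H -> H) (s : nat -> bool) (b : nat -> H -> H).

(** This is r_{s(k)} b_k r_{s(k+1)} ... b_{k+d-1} r_{s(k+d)}, with [d] coefficients and d + 1
    resolvents. The start [k] varies so that a tail is again a word. *)
Fixpoint word r s b d k : H -> H :=
  if d is d'.+1 then r (s k) \o b k \o word r s b d' k.+1 else r (s k).

Lemma word_scale r s b (t : nat -> R[i]) d k :
  (forall e, linear (r e)) -> (forall j, linear (b j)) ->
  word r s (fun j => t j *: b j) d k =
  scalar_op (\prod_(k <= j < k + d) t j) \o word r s b d k.
Proof.
move=> lr lb; apply/funext; elim: d k => [|d IH] k x /=.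
  by rewrite addn0 big_geq// /scalar_op scale1r.
have -> : \prod_(k <= j < k + d.+1) t j = t k * \prod_(k.+1 <= j < k.+1 + d) t j.
  by rewrite addSnnS big_ltn// -addSnnS leq_addr.
rewrite IH /scalar_op -[X in r _ X]/(t k *: b k _) (linZ _ _ (lb _)) scalerA.
exact: linZ (lr _).
Qed.

End Words.

(** * Inverting a triangular operator matrix *)

Section PathMatrix.
Variables (R : realType) (H : hilbertType R) (A : set (H -> H)).
Variables (a : set (H * H)) (r : bool -> H -> H).
Hypotheses (vA : von_neumann A) (Ar : forall e, A (r e)).
Hypothesis hr : forall e, shift_inverse a (signed_i R e) (r e).
Variables (m : nat) (s : nat -> bool) (b : nat -> H -> H).
Hypothesis Ab : forall k, A (b k).
Local Notation N := (2 * m.+1)%N.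

(* Letter k of a word sits at index 2k + 1 or 2k according to its sign [s k], as
   [diag_mx_op] has i at even and -i at odd indices.  Every row of block k of
   [path_mx] has its entry b_k in the column of letter k + 1. *)
Definition path_next k := (2 * k.+1 + ~~ s k.+1)%N.

Definition diag_mx_op : 'M[H -> H]_N :=
  \matrix_(i, j) (if i == j then scalar_op (signed_i R (odd i)) else 0).

Definition path_mx : 'M[H -> H]_N :=
  \matrix_(i, j) (if val j == path_next i./2 then b i./2 else 0).

(* Back substitution for D + N - a; [d] is the number of blocks from row [i] on. *)
Fixpoint path_inv d (i j : nat) : H -> H :=
  if d is d'.+1 then
    r (~~ odd i) \o
      (- (i == j)%:R *: id + (b i./2 \o path_inv d' (path_next i./2) j))
  else scalar_op 0.

Definition path_inv_mx : 'M[H -> H]_N :=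
  \matrix_(i, j) path_inv (m.+1 - i./2) i j.

(** [path_next] of the last block points past the matrix; extension by 0 lets the last rows obey the
    same formula as the others. *)
Definition extend0 (v : 'I_N -> H) (k : nat) : H :=
  if insub k is Some j then v j else 0.

Lemma extend0_ord v (i : 'I_N) : extend0 v i = v i.
Proof. by rewrite /extend0 valK. Qed.

Lemma extend0_ge v k : (N <= k)%N -> extend0 v k = 0.
Proof. by move=> Nk; rewrite /extend0 insubF// ltnNge Nk. Qed.

Let lb k : linear (b k).
Proof. exact: ((vN_star vA).1 _ (Ab k)).1. Qed.

Let lr e : linear (r e).
Proof. exact: ((vN_star vA).1 _ (Ar e)).1. Qed.

Lemma path_mx_act v i : mx_act path_mx v i = b i./2 (extend0 v (path_next i./2)).
Proof.
rewrite /mx_act; under eq_bigr do rewrite mxE.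
have [lt|ge] := ltnP (path_next i./2) N.
  rewrite (bigD1 (Ordinal lt))//= eqxx big1 => [|j ji]; last first.
    by rewrite ifN.
  by rewrite addr0 -(extend0_ord v (Ordinal lt)).
rewrite extend0_ge// (lin0 (lb _)) big1// => j _; rewrite ifN//.
by rewrite neq_ltn (leq_trans (ltn_ord j) ge).
Qed.

Lemma diag_path_mx_act v i : mx_act (diag_mx_op + path_mx) v i =
  signed_i R (odd i) *: v i + b i./2 (extend0 v (path_next i./2)).
Proof.
rewrite -path_mx_act /mx_act.
transitivity (\sum_j (diag_mx_op i j (v j) + path_mx i j (v j))).
  by apply: eq_bigr => j _; rewrite mxE.
rewrite big_split/=; congr (_ + _); rewrite (bigD1 i)//= mxE eqxx big1 ?addr0//.
by move=> j ji; rewrite mxE eq_sym (negPf ji).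
Qed.

Fixpoint path_sol (u : 'I_N -> H) d i : H :=
  if d is d'.+1 then
    r (~~ odd i) (b i./2 (path_sol u d' (path_next i./2)) - extend0 u i)
  else 0.

Lemma path_inv_sol u d i : \sum_(j < N) path_inv d i j (u j) = path_sol u d i.
Proof.
elim: d i => [|d IH] i /=; first by rewrite big1// => j _; rewrite /scalar_op scale0r.
rewrite -IH (lin_sum _ _ (lb _)) -(lin_sum _ _ (lr _)); congr (r _ _).
rewrite addrC [LHS](_ : _ = \sum_(j < N) (- (i == j)%:R *: u j +
  b i./2 (path_inv d (path_next i./2) j (u j))))//.
rewrite big_split/=; congr (_ + _).
under eq_bigr do rewrite scaleNr.
rewrite sumrN; congr (- _).
have [lt|ge] := ltnP i N; last first.
  rewrite extend0_ge// big1// => j _.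
  by rewrite gtn_eqF ?scale0r// (leq_trans (ltn_ord j)).
rewrite (bigD1 (Ordinal lt))//= eqxx scale1r big1 => [|j ji].
  by rewrite addr0 -(extend0_ord u (Ordinal lt)).
rewrite (_ : (i == j :> nat) = false) ?scale0r//.
by apply/negbTE; rewrite eq_sym.
Qed.

Lemma half_path_next k : (path_next k)./2 = k.+1.
Proof. by rewrite /path_next mul2n addnC half_bit_double. Qed.

Lemma fuel_path_next i : (i < N)%N ->
  (m.+1 - i./2 = (m.+1 - (path_next i./2)./2).+1)%N.
Proof.
move=> iN; rewrite half_path_next subSS subSn// -ltnS -(@ltn_pmul2l 2)//.
by apply: leq_ltn_trans iN; rewrite mul2n -[leqRHS](odd_double_half i) leq_addl.
Qed.

Lemma fuel_ge i : (N <= i)%N -> (m.+1 - i./2 = 0)%N.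
Proof.
move=> Ni; apply/eqP; rewrite subn_eq0.
by have := half_leq Ni; rewrite mul2n doubleK.
Qed.

Lemma path_inv_mx_act u i :
  mx_act path_inv_mx u i = path_sol u (m.+1 - i./2) i.
Proof. by rewrite -path_inv_sol; apply: eq_bigr => j _; rewrite mxE. Qed.

Lemma extend0_path_inv u k :
  extend0 (mx_act path_inv_mx u) k = path_sol u (m.+1 - k./2) k.
Proof.
have [lt|ge] := ltnP k N; last by rewrite extend0_ge// fuel_ge.
by rewrite (extend0_ord _ (Ordinal lt)) path_inv_mx_act.
Qed.

Lemma path_inv_in d i j : A (path_inv d i j).
Proof.
elim: d i => [|d IH] i /=; first exact: vN_scalar.
apply: vN_comp => //; apply: vN_lincomb => //; first exact: vN_id.
exact: vN_comp.
Qed.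

(** The left identity goes by induction on the number of remaining blocks, since each row involves
    only the next block. The right identity is one unfolding of the recursion together with the
    graph property of [r]. *)
Lemma path_mx_inverse : mx_inverse A a (diag_mx_op + path_mx) path_inv_mx.
Proof.
split=> [i j|v w avw|u i].
- by rewrite mxE; exact: path_inv_in.
- set z := fun i => _ ; apply/funext => i; rewrite path_inv_mx_act.
  rewrite -(extend0_ord v); move: (val i) => {}i.
  have [d di] : exists d, (m.+1 - i./2 = d)%N by exists (m.+1 - i./2)%N.
  rewrite di; elim: d i di => [|d IH] i di.
    rewrite extend0_ge// leqNgt; apply/negP => /fuel_path_next.
    by rewrite di.
  have iN : (i < N)%N by rewrite ltnNge; apply/negP => /fuel_ge; rewrite di.
  rewrite /= IH; last by move: (fuel_path_next iN); rewrite di => -[].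
  rewrite !(extend0_ord _ (Ordinal iN)) /z diag_path_mx_act /=.
  have [_ rK _] := hr (~~ odd i).
  rewrite -[RHS](rK _ _ (avw (Ordinal iN))) -signed_iN; congr (r _ _).
  by rewrite opprB addrC opprD addrA subrK scaleNr.
- have [_ _ ar] := hr (~~ odd i).
  rewrite diag_path_mx_act extend0_path_inv path_inv_mx_act.
  rewrite (fuel_path_next (ltn_ord i)) /=.
  set y := b _ _ - _; have := ar y; rewrite -signed_iN scaleNr opprK.
  rewrite [y + _]addrC; congr (a (_, _)).
  by rewrite /y extend0_ord addrA.
Qed.

(** On the way to the column of letter [m] the diagonal term of the recursion vanishes except in the
    last row, where it contributes the single factor -1. *)
Lemma path_inv_word d k : (k + d)%N = m ->
  path_inv d.+1 (2 * k + ~~ s k) (2 * m + ~~ s m) = scalar_op (-1) \o word r s b d k.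
Proof.
have o2 l (e : bool) : odd (2 * l + e) = e by rewrite oddD oddM/= oddb.
have h2 l (e : bool) : (2 * l + e)./2 = l by rewrite mul2n addnC half_bit_double.
elim: d k => [|d IH] k kd; apply/funext => x.
  rewrite addn0 in kd; rewrite -kd /= eqxx o2 negbK.
  rewrite -[X in r _ X]/(-1 *: x + b _ _) /scalar_op scale0r (lin0 (lb _)) addr0.
  exact: linZ (lr _).
pose i := (2 * k + ~~ s k)%N; pose j := (2 * m + ~~ s m)%N.
rewrite -[LHS]/(r (~~ odd i) (- (i == j)%:R *: x +
  b i./2 (path_inv d.+1 (path_next i./2) j x))) o2 negbK h2.
have -> : (i == j) = false.
  by apply/negbTE/eqP => /(congr1 half); rewrite !h2 -kd => /eqP; rewrite -{1}[k]addn0 eqn_add2l.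
rewrite oppr0 scale0r add0r IH ?addSnnS// /scalar_op /=.
by rewrite (linZ _ _ (lb _)) (linZ _ _ (lr _)).
Qed.

(** [resolvent] is a choice, so the inverse must be unique: the left identity of [path_inv_mx]
    applied to the right identity of any other inverse gives the same action on vectors. *)
Lemma resolvent_path : resolvent A a (diag_mx_op + path_mx) = path_inv_mx.
Proof.
have inv := path_mx_inverse.
have [cA cK ac] : mx_inverse A a (diag_mx_op + path_mx)
    (resolvent A a (diag_mx_op + path_mx)).
  exact: (@xgetI _ 0 [set c | mx_inverse A a (diag_mx_op + path_mx) c] _ inv).
set c := resolvent _ _ _ in cA cK ac *.
have cE u : mx_act path_inv_mx u = mx_act c u.
  have [_ iK _] := inv; rewrite -[RHS](iK _ _ (ac u)).
  congr mx_act; apply/funext => i.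
  by rewrite opprB addrC subrK.
(* Vectors with one nonzero component recover the entries of a matrix from its action. *)
have lin_mx (x : 'M[H -> H]_N) i j v : mx_over A x ->
    mx_act x (fun k => if k == j then v else 0) i = x i j v.
  move=> xA; have lx k : linear (x i k) by exact: ((vN_star vA).1 _ (xA i k)).1.
  rewrite /mx_act (bigD1 j)//= eqxx big1 ?addr0// => k kj.
  by rewrite (negPf kj) (lin0 (lx _)).
have [iA _ _] := inv.
apply/matrixP => i j; apply/funext => v.
by rewrite -(lin_mx c)// -(lin_mx path_inv_mx)// cE.
Qed.

End PathMatrix.

(** * Small triangular perturbations inside Omega *)

Section OmegaMembership.
Variables (R : realType) (H : hilbertType R).
Implicit Types (x y v : H) (e : bool).

Lemma scalar_opE (c : R[i]) x : scalar_op c x = c *: x. Proof. by []. Qed.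

Lemma Im_signed_i e :
  Im_op (scalar_op (signed_i R e)) = scalar_op ((-1) ^+ e) :> (H -> H).
Proof.
rewrite /Im_op adj_scalar conj_signed_i; apply/funext => x.
rewrite -[LHS]/((2 * 'i)^-1 *: (signed_i R e *: x - (- signed_i R e) *: x)).
rewrite scaleNr opprK -scalerDl scalerA scalar_opE; congr (_ *: _).
have i2 : (2 * 'i : R[i]) != 0 by rewrite mulf_neq0// ?pnatr_eq0// neq0Ci.
case: e; rewrite /signed_i /= ?expr1 ?expr0 -?opprD -['i + 'i]/('i *+ 2).
  by rewrite -(mulr_natl 'i 2) mulrN mulVf.
by rewrite -(mulr_natl 'i 2) mulVf.
Qed.

(** [abs_op] is a choice, so uniqueness of the positive root is needed: if S^2 = 1 then S w = - w
    for w = S v - v, and positivity gives w = 0. *)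
Lemma abs_sign e : abs_op (scalar_op ((-1) ^+ e)) = id :> (H -> H).
Proof.
have sq : adj (scalar_op ((-1) ^+ e)) \o scalar_op ((-1) ^+ e) = id :> (H -> H).
  rewrite adj_scalar; apply/funext => x /=.
  rewrite !scalar_opE scalerA rmorphXn rmorphN1 -exprMn_comm//.
  by rewrite mulrNN mulr1 expr1n scale1r.
have [] : [set S : H -> H | [/\ bounded_op S, positive_op S & S \o S =
    adj (scalar_op ((-1) ^+ e)) \o scalar_op ((-1) ^+ e)]]
    (abs_op (scalar_op ((-1) ^+ e))).
  apply: (@xgetI _ 0 _ id); split; [exact: bounded_op_id| |by rewrite sq].
  by move=> v; rewrite dotxx ler0c sqr_ge0.
move: (abs_op _) => S bS pS; rewrite sq => SS; apply/funext => v.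
have Sw : S (S v - v) = - (S v - v).
  by rewrite (linB _ _ bS.1) -[S (S v)]/((S \o S) v) SS opprB.
apply/eqP; rewrite -subr_eq0; apply/eqP/dot_eq0/eqP.
have := pS (S v - v); rewrite Sw -[- _]scaleN1r dotZl mulN1r oppr_ge0 => le0.
by rewrite eq_le le0 dotxx ler0c sqr_ge0.
Qed.

(** The imaginary parts of the centre have modulus 1, so the ball has radius 1; a nonzero vector
    ensures that 1 is the largest admissible constant. The bound on the entries keeps the
    perturbation at norm at most 1/2. *)
Lemma diag_path_Omega (B : set (H -> H)) m s (b : nat -> H -> H) :
  von_neumann B -> (forall k, B (b k)) ->
  (exists v : H, v != 0) ->
  (forall k x, nrm (b k x) <= (2 * (2 * m.+1)%:R)^-1 * nrm x) ->
  Omega B (diag_mx_op H m + path_mx m s b).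
Proof.
move=> vB Bb [v v0] hb.
have B0 : B 0.
  suff -> : 0 = scalar_op 0 :> (H -> H) by exact: vN_scalar.
  by apply/funext => x; rewrite scalar_opE scale0r.
split.
  move=> i j; rewrite !mxE -[X in B (X + _)]scale1r; apply: vN_lincomb => //.
    by case: ifP => // _; exact: vN_scalar.
  by case: ifP.
exists (fun i => scalar_op (signed_i R (odd i))), 1; split=> //.
- move=> i; case: ifP => oi; (split; first exact: vN_scalar); exists 1 => //;
    rewrite Im_signed_i oi => w.
    by rewrite -[X in dot H X _]/(_ *: w - _ *: w) expr1 rmorph1 subrr dot0l.
  by rewrite -[X in dot H X _]/(_ *: w - _ *: w) expr0 rmorph1 subrr dot0l.
- split=> [i w|s' /(_ ord0) /(_ v)].
    by rewrite Im_signed_i abs_sign -[X in dot H X _]/(w - _ *: w) rmorph1 scale1r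
      subrr dot0l.
  rewrite Im_signed_i abs_sign -[X in dot H X _]/(v - _ *: v) -{1}[v]scale1r.
  rewrite -scalerBl dotZl pmulr_lge0; last first.
    by rewrite lt0r dotxx ler0c sqr_ge0 andbT -dotxx; apply: contra_neq v0 => /dot_eq0.
  by rewrite subr_ge0 -(rmorph1 (real_complex R)) lecR.
- rewrite -/(diag_mx_op H m) addrC addKr.
  have n0 : 0 < (2 * m.+1)%:R :> R by rewrite ltr0n.
  set n : R := (2 * m.+1)%:R in hb n0 *.
  have : 2^-1 < 1 :> R by lra.
  apply: le_lt_trans; apply: ge_inf; first by exists 0 => x [].
  split=> [|w]; first by rewrite invr_ge0.
  have lb k : linear (b k) by exact: ((vN_star vB).1 _ (Bb k)).1.
  pose K := \sum_(i < 2 * m.+1) nrm (w i) ^+ 2.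
  have -> : \sum_i `|w i| ^+ 2 = K%:C%C.
    by rewrite rmorph_sum; apply: eq_bigr => i _; rewrite nrmE rmorphXn.
  have hK k : nrm (extend0 w k) ^+ 2 <= K.
    rewrite /extend0; case: insubP => [j _ _|_]; last first.
      by rewrite nrm0 expr0n sumr_ge0// => i _; rewrite sqr_ge0.
    by rewrite /K (bigD1 j)//= lerDl sumr_ge0// => i _; rewrite sqr_ge0.
  have K0 : 0 <= K by rewrite sumr_ge0// => i _; rewrite sqr_ge0.
  rewrite -rmorphM (_ : \sum_i _ =
    (\sum_i nrm (mx_act (path_mx m s b) w i) ^+ 2)%:C%C); last first.
    by rewrite rmorph_sum; apply: eq_bigr => i _; rewrite nrmE rmorphXn.
  (* Each of the n rows has at most one nonzero entry, of norm at most 1/(2n), so the rows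
     contribute at most n K / (4 n^2), hence at most K/4. *)
  rewrite lecR; apply: (@le_trans _ _ (\sum_(i < 2 * m.+1) ((2 * n)^-1 ^+ 2 * K))).
    apply: ler_sum => i _; rewrite (path_mx_act (A := B))//.
    rewrite (le_trans _ (ler_wpM2l (sqr_ge0 _) (hK (path_next s i./2))))//.
    rewrite -exprMn ler_pXn2r ?nnegrE ?nrm_ge0// mulr_ge0 ?nrm_ge0// invr_ge0.
    by rewrite mulr_ge0// ltW.
  rewrite sumr_const card_ord -[leLHS]mulr_natl -/n mulrA ler_wpM2r//.
  have n1 : 1 <= n by rewrite ler1n.
  rewrite !expr2 !invfM mulrCA -!mulrA [n * _]mulrCA !mulrA.
  have -> : 2^-1 / n * 2^-1 * n / n = 2^-1 * 2^-1 / n by field; lra.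
  by rewrite ler_piMr// invf_le1.
Qed.

End OmegaMembership.

(** * Equality of the B-valued moments of words *)

Section WordMoments.
Variables (R : realType) (H : hilbertType R) (P : tracial_space H).
Variables (a1 a2 : set (H * H)) (r1 r2 : bool -> H -> H).
Hypotheses (af1 : affiliated_sa (algA P) a1) (af2 : affiliated_sa (algA P) a2).
Hypothesis hr1 : forall e, shift_inverse a1 (signed_i R e) (r1 e).
Hypothesis hr2 : forall e, shift_inverse a2 (signed_i R e) (r2 e).
Hypothesis G12 : forall n : nat, (0 < n)%N -> forall b : 'M[H -> H]_(2 * n),
  Omega (algB P) b -> cauchy_transform P a1 b = cauchy_transform P a2 b.

Let vA := algA_vN P.
Let vB := algB_vN P.

Lemma traceE x : algA P x -> trace P x = dot H (x (one_vec P)) (one_vec P).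
Proof.
move=> Ax; have Ai := vN_id vA.
rewrite -(one_vecE Ax Ai); congr (trace P _); apply/funext => v /=.
suff -> : adj id = id :> (H -> H) by [].
by apply: adj_unique => //; exact: bounded_op_id.
Qed.

Lemma one_vec_neq0 : one_vec P != 0.
Proof.
apply/eqP => x0; have [_ _] := trace_state P.
rewrite (traceE (vN_id vA)) x0 dot0r => /eqP.
by rewrite eq_sym oner_eq0.
Qed.

Lemma word_in r s b d k : (forall e, algA P (r e)) ->
  (forall j, algB P (b j)) -> algA P (word r s b d k).
Proof.
move=> Ar Bb; elim: d k => [|d IH] k //=.
apply: (vN_comp vA) => //; apply: (vN_comp vA) => //.
exact: (algB_sub (Bb _)).
Qed.

Lemma cexp_scale (c : R[i]) x : algA P x ->
  cexp P (scalar_op c \o x) = scalar_op c \o cexp P x.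
Proof.
move=> Ax; have := @cexp_bimodular _ _ P _ _ _ (vN_scalar c vB) Ax (vN_id vB).
by [].
Qed.

(** The coefficients are shrunk to bring the matrix into Omega. The entry joining letter 0 to letter
    [d] is then the word times a nonzero scalar, which passes through the expectation and
    cancels. *)
Lemma word_cexp s b d : (forall k, algB P (b k)) ->
  cexp P (word r1 s b d 0) = cexp P (word r2 s b d 0).
Proof.
move=> Bb.
have Ar1 e : algA P (r1 e) by exact: affiliated_shift_inverse (hr1 e).
have Ar2 e : algA P (r2 e) by exact: affiliated_shift_inverse (hr2 e).
have lb k : linear (b k) by exact: ((vN_star vB).1 _ (Bb k)).1.
have l1 e : linear (r1 e) by exact: ((vN_star vA).1 _ (Ar1 e)).1.
have l2 e : linear (r2 e) by exact: ((vN_star vA).1 _ (Ar2 e)).1.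
(* The entry bound of [diag_path_Omega] for d + 1 blocks. *)
pose dl : R := (2 * (2 * d.+1)%:R)^-1.
have dl0 : 0 < dl by rewrite invr_gt0 mulr_gt0// ltr0n.
have /choice[t ht] k : exists t : R, 0 < t /\
    forall x, t * nrm (b k x) <= dl * nrm x.
  have /bounded_opP[_ [C C0 hC]] := (vN_star vB).1 _ (Bb k).
  exists (dl / (C + 1)); split=> [|x]; first by rewrite divr_gt0// ltr_wpDl.
  rewrite -mulrA ler_pM2l// mulrC ler_pdivrMr ?ltr_wpDl//.
  by rewrite (le_trans (hC x))// mulrC ler_wpM2l ?nrm_ge0// lerDl.
pose b' k := (t k)%:C%C *: b k.
have Bb' k : algB P (b' k).
  suff -> : b' k = scalar_op (t k)%:C%C \o b k.
    by apply: (vN_comp vB) => //; exact: vN_scalar.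
  by [].
have Ab' k : algA P (b' k) by exact: algB_sub.
have Om : Omega (algB P) (diag_mx_op H d + path_mx d s b').
  apply: diag_path_Omega => //; first by exists (one_vec P); exact: one_vec_neq0.
  move=> k x; rewrite -[b' k x]/((t k)%:C%C *: b k x) nrmZr ?(ltW (ht k).1)//.
  exact: (ht k).2.
have := G12 (ltn0Sn d) Om; rewrite /cauchy_transform.
rewrite (resolvent_path vA Ar1 hr1 d s Ab') (resolvent_path vA Ar2 hr2 d s Ab').
have i0lt : (~~ s 0%N < 2 * d.+1)%N by case: (s 0%N); rewrite mul2n.
have jlt : (2 * d + ~~ s d < 2 * d.+1)%N.
  by rewrite mulnS addnC ltn_add2r; case: (s d).
move/matrixP/(_ (Ordinal i0lt) (Ordinal jlt)).
have i0h : (~~ s 0%N)./2 = 0%N by case: (s 0%N).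
rewrite !mxE /= i0h subn0.
have W r : (forall e, algA P (r e)) ->
    path_inv r s b' d.+1 (~~ s 0%N) (2 * d + ~~ s d) =
    scalar_op (-1) \o word r s b' d 0.
  by move=> Ar; exact: (path_inv_word vA Ar s Ab' (k := 0%N) (add0n d)).
rewrite (W r1)// (W r2)// /b' !word_scale//.
set c := \prod_(_ <= j < _) _.
have c0 : c != 0.
  rewrite /c prodf_seq_neq0; apply/allP => k _ /=.
  by rewrite gt_eqF// ltcR; case: (ht k).
have Aw1 : algA P (word r1 s b d 0) by exact: word_in.
have Aw2 : algA P (word r2 s b d 0) by exact: word_in.
have As c' x : algA P x -> algA P (scalar_op c' \o x).
  by move=> Ax; apply: (vN_comp vA) => //; exact: vN_scalar.
rewrite (cexp_scale _ (As _ _ Aw1)) (cexp_scale _ (As _ _ Aw2)) !cexp_scale//.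
move=> e; apply/funext => x; have := congr1 (fun f => f x) e.
rewrite /= !scalar_opE !scalerA; apply: scalerI.
by rewrite mulN1r oppr_eq0.
Qed.

End WordMoments.

(** * Lifting along a partial isometry *)

Lemma total_sub (R : realType) (H : hilbertType R) (D D' : set H) :
  D `<=` D' -> total D -> total D'.
Proof. by move=> DD' tD w ow; apply: tD => d /DD'; exact: ow. Qed.

Section CyclicCommutant.
Variables (R : realType) (H : hilbertType R).

(** The partial isometry of the identity relation on [D] is the projection onto the closure of
    [D]. *)
Lemma orthogonal_projection (D : set H) : subspace D ->
  exists e, [/\ bounded_op e, forall d, D d -> e d = d,
    forall k, orthocomp D k -> e k = 0,
    e \o e = e & forall x y, dot H (e x) y = dot H x (e y)].
Proof.
move=> [D0 Dl]; pose G := [set p : H * H | D p.1 /\ p.2 = p.1].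
have G1 : [set p.1 | p in G] = D.
  apply/seteqP; split=> [_ [p [Dp _] <-]//|d Dd].
  by exists (d, d).
have G2 : [set p.2 | p in G] = D.
  apply/seteqP; split=> [_ [p [Dp ->] <-]//|d Dd].
  by exists (d, d).
have [||p q [_ ->] [_ ->]//|e [be e1 e0 e1' e0']] := @partial_isometry _ _ G.
- by split.
- by move=> c p q [Dp ->] [Dq ->]; split; first exact: Dl.
rewrite G1 in e0; rewrite G2 in e0'.
have eD d : D d -> e d = d by move=> Dd; apply: (e1 (d, d)).
have eD' d : D d -> adj e d = d by move=> Dd; apply: (e1' (d, d)).
have tD := total_orthocomp D0; have be' := adj_bounded be.
exists e; split=> //.
  apply: (eq_on_total tD) => //; first exact: bounded_op_comp.
  move=> _ [d Dd [k k0 <-]] /=.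
  by rewrite (linD _ _ be.1) (eD d)// (e0 k)// addr0 eD.
move=> x y; rewrite dot_adjr//; suff -> : adj e = e by [].
apply: (eq_on_total tD) => // _ [d Dd [k k0 <-]] /=.
by rewrite (linD _ _ be.1) (linD _ _ be'.1) eD// eD'// e0// e0'.
Qed.

(** A separating vector is cyclic for the commutant. The projection e onto the closure of A' xi
    commutes with A', so it lies in A; p = 1 - e is positive with tau(p) = <p xi, xi> = 0, and
    faithfulness gives p = 0. *)
Lemma one_vec_commutant_total (P : tracial_space H) :
  total [set m (one_vec P) | m in commutant (algA P)].
Proof.
set D := [set _ | _ in _]; have vA := algA_vN P; have sA := vN_star vA.
have sD : subspace D.
  split=> [|c _ _ [m cm <-] [m' cm' <-]].
    exists (scalar_op 0); first exact: commutant_scalar sA.1.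
    exact: scale0r.
  by exists (c *: m + m') => //; exact: commutant_lincomb sA.1 _ _.
have [e [be eD e0 ee es]] := orthogonal_projection sD.
have tD := total_orthocomp sD.1.
have Ae : algA P e.
  have [_ _ <-] := vA; apply: commutantI => // m x cm.
  suff : e \o m = m \o e by move/(congr1 (fun f => f x)).
  apply: (eq_on_total tD) => [||_ [_ [m' cm' <-] [k k0 <-]]] /=.
  - exact: bounded_op_comp cm.1.
  - exact: bounded_op_comp cm.1 _.
  rewrite (linD _ _ be.1) !(linD _ _ (cm.1).1) (linD _ _ be.1) (e0 k)//.
  rewrite (eD (m' _)); last by exists m'.
  rewrite (eD (m _)); last by exists (m \o m') => //; exact: commutant_comp.
  rewrite (lin0 (cm.1).1) (e0 (m k))// => _ [m1 cm1 <-].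
  rewrite (dot_adjl _ _ cm.1); apply: k0; exists (adj m \o m1) => //.
  by apply: commutant_comp => //; exact: commutant_adj.
have exi : e (one_vec P) = one_vec P.
  by apply: eD; exists id => //; exact: commutant_id.
pose p : H -> H := (-1) *: e + id.
have pE x : p x = x - e x by rewrite addrC -scaleN1r.
have Ap : algA P p by apply: vN_lincomb => //; exact: vN_id.
have p0 : p = 0.
  apply: (@trace_faithful _ _ P) => //.
    move=> v; have -> : dot H (p v) v = dot H (p v) (p v).
      rewrite [in RHS]pE dotBr -es pE (linB _ _ be.1) -[e (e v)]/((e \o e) v) ee.
      by rewrite subrr dot0l subr0.
    by rewrite dotxx ler0c sqr_ge0.
  by rewrite traceE// pE exi subrr dot0l.
move=> w ow; have := congr1 (fun f => f w) p0.
by rewrite pE (e0 w)// subr0.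
Qed.

End CyclicCommutant.

(** For a_j = q_j / (q0 c^(2^j)) the hypotheses read a_j^2 <= a_{j+1} with a_j bounded, so a_0 <= 1,
    since otherwise iterated squares diverge. The conclusion does not involve [K], which is what
    makes the bound on T uniform in n. *)
Lemma doubling_bound (R : realType) (q : nat -> R) (q0 c K : R) :
  0 < c -> 0 <= q0 -> (forall j, 0 <= q j) ->
  (forall j, q j ^+ 2 <= q0 * q j.+1) ->
  (forall j, q j <= K * c ^+ (2 ^ j)) -> q 0%N <= c * q0.
Proof.
move=> c0; rewrite le_eqVlt => /predU1P[<-|q00] qpos q2 qK.
  by have := q2 0%N; rewrite mul0r mulr0; have := qpos 0%N; nra.
pose a j := q j / (q0 * c ^+ (2 ^ j)).
have den j : 0 < q0 * c ^+ (2 ^ j) by rewrite mulr_gt0// exprn_gt0.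
have a2 j : a j ^+ 2 <= a j.+1.
  rewrite /a expr_div_n ler_pdivrMr ?exprn_gt0// mulrAC ler_pdivlMr//.
  rewrite expnSr exprM exprMn [X in _ <= X](_ : _ = (q0 * q j.+1) *
    (q0 * (c ^+ (2 ^ j)) ^+ 2)); last by ring.
  by rewrite ler_wpM2r// -exprM -expnSr ltW.
have aK j : a j <= K / q0.
  rewrite /a ler_pdivrMr// (le_trans (qK j))// mulrA divfK ?gt_eqF//.
suff : a 0%N <= 1.
  have := den 0%N; rewrite /a expn0 expr1 => d0.
  by rewrite ler_pdivrMr// mul1r mulrC.
rewrite leNgt; apply/negP => a1; pose h := a 0%N - 1.
have h0 : 0 < h by rewrite subr_gt0.
(* Linear growth already contradicts boundedness: (1 + t h)^2 >= 1 + (t + 1) h for t >= 1. *)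
have ah j : 1 + j.+1%:R * h <= a j.
  elim: j => [|j IH]; first by rewrite mul1r addrC subrK.
  apply: le_trans (a2 j); rewrite -[j.+2]addn1 natrD.
  have : 1 <= j.+1%:R :> R by rewrite ler1n.
  move: (j.+1%:R) IH => t IH t1; rewrite expr2.
  have : 0 <= t * h by rewrite mulr_ge0// ?ltW//; lra.
  by nra.
have B0 : 0 < Num.max 1 (K / q0) by rewrite lt_max ltr01.
have [N hN] := natSinv_lt (divr_gt0 h0 B0).
have := hN N (leqnn N); rewrite ltr_pdivlMr// mulrC ltr_pdivrMr ?ltr0n// => BN.
have KB : K / q0 <= Num.max 1 (K / q0) by rewrite le_max lexx orbT.
have := le_trans (ah N) (le_trans (aK N) KB); rewrite mulrC.
by move: BN; move: (Num.max _ _) (h * _) => B t; lra.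
Qed.

(** * Extending a compressed operator to the whole space *)

Section Lifting.
Variables (R : realType) (H : hilbertType R).
Variables (M1 M2 : set (H -> H)) (U : H -> H) (xi : H).
Hypotheses (sM1 : star_closed M1) (sM2 : star_closed M2).
Hypotheses (bU : bounded_op U) (UVU : U \o adj U \o U = U).
Hypothesis conjU : forall n, commutant M2 n -> commutant M1 (adj U \o n \o U).
Hypothesis rangeU : commutant M2 (U \o adj U).
Hypotheses (Uxi : U xi = xi) (Vxi : adj U xi = xi).
Hypothesis txi : total [set n xi | n in commutant M2].

Local Notation V := (adj U).
Local Notation T z := (U \o z \o V).

Let bV : bounded_op V. Proof. exact: adj_bounded. Qed.

Let UVUE x : U (V (U x)) = U x.
Proof. exact: (congr1 (fun f => f x) UVU). Qed.

Let VUVE x : V (U (V x)) = V x.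
Proof.
by apply: dot_inj => z; rewrite -!dot_adjr// dot_adjl// -dot_adjr// UVUE.
Qed.

(** z in M1'' commutes with V n U in M1'; applying U on the left and V on the right makes T z
    commute with n up to the range projection U V. *)
Lemma lift_commute z n x : commutant (commutant M1) z -> commutant M2 n ->
  U (V (n (T z x))) = T z (n (U (V x))).
Proof.
move=> cz cn /=; have := commutantE (V x) cz (conjU cn).
by move=> /= ->.
Qed.

Lemma lift_comp z w : commutant (commutant M1) z -> commutant (commutant M1) w ->
  T z \o T w = T (z \o w).
Proof.
move=> cz cw; apply/funext => x /=.
have := commutantE (V x) cw (conjU (commutant_id M2)); move=> /= <-.
by rewrite VUVE.
Qed.

Lemma lift_adj z : bounded_op z -> adj (T z) = T (adj z).
Proof.
move=> bz; rewrite adj_comp//; last exact: bounded_op_comp.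
by rewrite adj_comp// adjK.
Qed.

Lemma lift_bicommutant_adj z :
  commutant (commutant M1) z -> commutant (commutant M1) (adj z).
Proof. by apply: commutant_adj; exact: commutant_star. Qed.

(* Iterating along z, z^* z, (z^* z)^2, ... bounds [n (T z xi)] by a multiple of
   [n xi] uniformly in [n]. *)
Lemma lift_CauchySchwarz z n : commutant (commutant M1) z -> commutant M2 n ->
  nrm (n (T z xi)) ^+ 2 <= nrm (n xi) * nrm (n (T (adj z \o z) xi)).
Proof.
move=> cz cn; have bz := cz.1; have bn := cn.1.
have cz' := lift_bicommutant_adj cz.
have cn' := commutant_adj sM2 cn; have cnn := commutant_comp cn' cn.
have bT : bounded_op (T z) by apply: bounded_op_comp => //; exact: bounded_op_comp.
(* T z xi lies in the range of U V, so U V can be inserted; it then carries n^* n across T z, and U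
   V xi = xi. *)
have e : dot H (n (T z xi)) (n (T z xi)) = dot H (n xi) (n (T (adj z \o z) xi)).
  rewrite (dot_adjl _ _ bn) -[X in dot H _ X = _](UVUE (z (V xi))).
  rewrite (dot_adjl _ _ bU) -(dot_adjr _ _ bU) (lift_commute xi cz cnn).
  have -> : U (V xi) = xi by rewrite Vxi Uxi.
  rewrite (dot_adjr _ _ bT) lift_adj// -[X in dot H _ X]/((T (adj z) \o T z) xi).
  by rewrite (lift_comp cz' cz) [RHS](dot_adjl _ _ bn).
rewrite -lecR -dotxx e -[leLHS]ger0_norm; first exact: CauchySchwarz_dot.
by rewrite -e dotxx ler0c sqr_ge0.
Qed.

(** The bound [Cn] of n enters only the constant [K] of [doubling_bound], hence not [c]. *)
Lemma lift_bound z : commutant (commutant M1) z ->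
  exists2 c, 0 <= c & forall n, commutant M2 n ->
    nrm (n (T z xi)) <= c * nrm (n xi).
Proof.
move=> cz; have [_ [C1 C10 hC1]] := (bounded_opP _).1 cz.1.
have [_ [C2 C20 hC2]] := (bounded_opP _).1 (lift_bicommutant_adj cz).1.
have [_ [CU CU0 hU]] := (bounded_opP _).1 bU.
pose c := C1 + C2 + 1; have c0 : 0 < c by rewrite /c; lra.
exists c; first exact: ltW.
move=> n cn; have [_ [Cn Cn0 hn]] := (bounded_opP _).1 cn.1.
pose fix zs j := if j is j'.+1 then adj (zs j') \o zs j' else z.
have czs j : commutant (commutant M1) (zs j).
  by elim: j => [|j IH] //=; apply: commutant_comp => //; exact: lift_bicommutant_adj.
have adjzs j : adj (zs j.+1) = zs j.+1.
  have bz := (czs j).1.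
  by rewrite /= adj_comp ?adjK//; exact: adj_bounded.
have nzs j : (forall v, nrm (zs j v) <= c ^+ (2 ^ j) * nrm v) /\
    (forall v, nrm (adj (zs j) v) <= c ^+ (2 ^ j) * nrm v).
  elim: j => [|j [IH IH']].
    rewrite expn0 expr1; split=> v; [apply: le_trans (hC1 v) _|apply: le_trans (hC2 v) _];
      by rewrite ler_wpM2r ?nrm_ge0// /c; lra.
  suff h v : nrm (zs j.+1 v) <= c ^+ (2 ^ j.+1) * nrm v.
    by split=> // v; rewrite adjzs.
  rewrite /= (le_trans (IH' _))// expnSr exprM expr2 -mulrA ler_wpM2l//.
  by rewrite exprn_ge0// ltW.
pose q j := nrm (n (T (zs j) xi)).
apply: (@doubling_bound _ q _ _ (Cn * CU * nrm xi)) => //.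
- exact: nrm_ge0.
- by move=> j; exact: nrm_ge0.
- by move=> j; exact: lift_CauchySchwarz.
- move=> j; rewrite /q (le_trans (hn _))// -!mulrA ler_wpM2l//= (le_trans (hU _))//.
  by rewrite ler_wpM2l// Vxi mulrC; exact: (nzs j).1.
Qed.

(* [y] is determined by [y (n xi) = n (U x U^* xi)] for [n] in the commutant of
   [M2]; compressed to the range of [U] it is [U x U^*]. *)
Lemma lift_ex x : commutant (commutant M1) x ->
  exists2 y, commutant (commutant M2) y & forall v, y (U v) = U (x (V (U v))).
Proof.
move=> cx; have [c c0 hc] := lift_bound cx.
pose G := [set (n xi, n (T x xi)) | n in commutant M2].
have bT : bounded_op (T x).
  by apply: bounded_op_comp => //; apply: bounded_op_comp => //; exact: cx.1.
have G1 : [set p.1 | p in G] = [set n xi | n in commutant M2].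
  apply/seteqP; split=> [_ [_ [n cn <-] <-]|_ [n cn <-]]; first by exists n.
  by exists (n xi, n (T x xi)) => //; exists n.
have [||_ [n cn <-]|//|y by_ yG] := @bounded_extension _ _ G c _ _ c0.
- exists (scalar_op 0); first exact: commutant_scalar sM2.1.
  by rewrite !scalar_opE !scale0r.
- move=> a _ _ [n cn <-] [n' cn' <-]; exists (a *: n + n') => //.
  exact: commutant_lincomb sM2.1 _ _.
- exact: hc.
- by rewrite G1.
have yE n : commutant M2 n -> y (n xi) = n (T x xi).
  by move=> cn; apply: (yG (n xi, n (T x xi))); exists n.
exists y.
  apply: commutantI => // m v cm; have bm := cm.1.
  suff : y \o m = m \o y by move/(congr1 (fun f => f v)).
  apply: (eq_on_total txi) => [||_ [n cn <-]]; [exact: bounded_op_comp..|] => /=.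
  by rewrite yE// -[y (m (n xi))]/(y ((m \o n) xi)) yE//; exact: commutant_comp.
(* U V n lies in M2', so y U V n xi = U V n T xi, which is T n xi by [lift_commute]. *)
move=> v; have yT : y \o (U \o V) = T x.
  apply: (eq_on_total txi) => // [|_ [n cn <-]].
    by apply: bounded_op_comp => //; exact: bounded_op_comp.
  have := lift_commute xi cx cn; rewrite Vxi Uxi => /= <-.
  rewrite -[LHS]/(y (((U \o V) \o n) xi)) yE//; exact: commutant_comp.
by rewrite -[in LHS](UVUE v) -[LHS]/((y \o (U \o V)) (U v)) yT.
Qed.

End Lifting.

(** * The isometry between polynomial vectors *)

Section MonomialPairs.
Variables (R : realType) (H : hilbertType R) (P : tracial_space H).
Variables (a1 a2 : set (H * H)) (r1 r2 : bool -> H -> H).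
Hypotheses (af1 : affiliated_sa (algA P) a1) (af2 : affiliated_sa (algA P) a2).
Hypothesis hr1 : forall e, shift_inverse a1 (signed_i R e) (r1 e).
Hypothesis hr2 : forall e, shift_inverse a2 (signed_i R e) (r2 e).
Hypothesis G12 : forall n : nat, (0 < n)%N -> forall b : 'M[H -> H]_(2 * n),
  Omega (algB P) b -> cauchy_transform P a1 b = cauchy_transform P a2 b.

Let vA := algA_vN P.
Let vB := algB_vN P.
Let xi := one_vec P.

Let Ar1 e : algA P (r1 e).
Proof. exact: affiliated_shift_inverse (hr1 e). Qed.

Let Ar2 e : algA P (r2 e).
Proof. exact: affiliated_shift_inverse (hr2 e). Qed.

(* The same noncommutative monomial evaluated at [a1] and at [a2]. *)
Inductive mono_pair : (H -> H) -> (H -> H) -> Prop :=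
| mono_id : mono_pair id id
| mono_B b x y : algB P b -> mono_pair x y -> mono_pair (b \o x) (b \o y)
| mono_r e x y : mono_pair x y -> mono_pair (r1 e \o x) (r2 e \o y).

Lemma mono_pair_in x y : mono_pair x y -> algA P x /\ algA P y.
Proof.
elim=> {x y} [|b x y Bb _ [Ax Ay]|e x y _ [Ax Ay]].
- by split; exact: vN_id.
- by split; apply: (vN_comp vA) => //; exact: algB_sub.
- by split; exact: (vN_comp vA).
Qed.

Lemma mono_pair_comp x y x' y' :
  mono_pair x y -> mono_pair x' y' -> mono_pair (x \o x') (y \o y').
Proof.
move=> + m'; elim=> {x y} [//|b x y Bb _ IH|e x y _ IH].
  exact: (mono_B Bb IH).
exact: (mono_r e IH).
Qed.

Lemma shift_adj (a : set (H * H)) (r : bool -> H -> H) e :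
  adjoint_graph a = a -> (forall e, shift_inverse a (signed_i R e) (r e)) ->
  adj (r e) = r (~~ e).
Proof.
move=> sa hr; apply: (shift_inverse_adj sa (conj_signed_i R e) (hr e)).
by rewrite signed_iN.
Qed.

Lemma mono_pair_adj x y : mono_pair x y -> mono_pair (adj x) (adj y).
Proof.
have Ab x' : algA P x' -> bounded_op x' by exact: (vN_star vA).1.
elim=> {x y} [|b x y Bb m IH|e x y m IH].
- suff -> : adj id = id :> (H -> H) by exact: mono_id.
  by apply: adj_unique => //; exact: bounded_op_id.
- have [Ax Ay] := mono_pair_in m; have bb := Ab _ (algB_sub Bb).
  rewrite (adj_comp bb (Ab _ Ax)) (adj_comp bb (Ab _ Ay)).
  apply: mono_pair_comp => //; rewrite -[adj b]/(adj b \o id).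
  by apply: mono_B; [exact: (vN_star vB).2|exact: mono_id].
- have [Ax Ay] := mono_pair_in m.
  rewrite (adj_comp (Ab _ (Ar1 e)) (Ab _ Ax)) (adj_comp (Ab _ (Ar2 e)) (Ab _ Ay)).
  apply: mono_pair_comp => //; rewrite (shift_adj _ af1.2 hr1) (shift_adj _ af2.2 hr2).
  exact: (mono_r (~~ e) mono_id).
Qed.

Lemma word_shift r (s s' : nat -> bool) (b b' : nat -> H -> H) d k :
  (forall j, s' j.+1 = s j) -> (forall j, b' j.+1 = b j) ->
  word r s' b' d k.+1 = word r s b d k.
Proof. by move=> hs hb; elim: d k => [|d IH] k /=; rewrite ?IH hs ?hb. Qed.

(** A normal form: adjacent elements of B merge, an identity separates adjacent resolvents, and one
    factor from B remains at each end. *)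
Lemma mono_pair_word x y : mono_pair x y -> exists2 b, algB P b &
  (x = b /\ y = b) \/ exists s d, exists2 b', algB P b' &
    exists2 bs : nat -> H -> H, (forall k, algB P (bs k)) &
      x = b \o word r1 s bs d 0 \o b' /\ y = b \o word r2 s bs d 0 \o b'.
Proof.
elim=> {x y} [|b x y Bb _ [b0 Bb0 h]|e x y _ [b0 Bb0 h]].
- by exists id; [exact: vN_id|left].
- exists (b \o b0); first exact: vN_comp.
  case: h => [[-> ->]|[s [d [b' Bb' [bs Bbs [-> ->]]]]]]; [by left|right].
  by exists s, d, b' => //; exists bs.
- exists id; first exact: vN_id.
  right; case: h => [[-> ->]|[s [d [b' Bb' [bs Bbs [-> ->]]]]]].
    exists (fun=> e), 0%N, b0 => //; exists (fun=> id) => // _.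
    exact: vN_id.
  exists (fun j => if j is j'.+1 then s j' else e), d.+1, b' => //.
  exists (fun j => if j is j'.+1 then bs j' else b0); first by case.
  by rewrite /= !(@word_shift _ s _ bs).
Qed.

(** The trace factors through the expectation, and bimodularity pulls out the two outer factors,
    leaving a word. *)
Lemma mono_pair_trace x y : mono_pair x y -> trace P x = trace P y.
Proof.
move=> /mono_pair_word[b Bb [[-> ->]//|[s [d [b' Bb' [bs Bbs [-> ->]]]]]]].
have Aw r : (forall e, algA P (r e)) -> algA P (word r s bs d 0).
  by move=> Ar; exact: word_in.
have Abw r : (forall e, algA P (r e)) -> algA P (b \o word r s bs d 0 \o b').
  move=> Ar; apply: (vN_comp vA); last exact: algB_sub.
  by apply: (vN_comp vA); [exact: algB_sub|exact: Aw].
rewrite -(cexp_trace (Abw _ Ar1)) -(cexp_trace (Abw _ Ar2)).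
rewrite (cexp_bimodular Bb (Aw _ Ar1) Bb') (cexp_bimodular Bb (Aw _ Ar2) Bb').
by rewrite (word_cexp af1 af2 hr1 hr2 G12).
Qed.

Lemma mono_pair_dot x y x' y' : mono_pair x y -> mono_pair x' y' ->
  dot H (y xi) (y' xi) = dot H (x xi) (x' xi).
Proof.
move=> m m'; have [Ax Ay] := mono_pair_in m; have [Ax' Ay'] := mono_pair_in m'.
rewrite -!one_vecE//; apply/esym/mono_pair_trace.
by apply: mono_pair_comp => //; exact: mono_pair_adj.
Qed.

(** A relation, since different polynomials may give the same vector at [a1]; [poly_pair_dot] shows
    that it is isometric, hence single-valued. *)
Inductive poly_pair : H -> H -> Prop :=
| poly_mono x y : mono_pair x y -> poly_pair (x xi) (y xi)
| poly_lincomb (c : R[i]) u v u' v' : poly_pair u v -> poly_pair u' v' ->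
    poly_pair (c *: u + u') (c *: v + v').

Lemma poly_pair_dot u v u' v' :
  poly_pair u v -> poly_pair u' v' -> dot H v v' = dot H u u'.
Proof.
move=> + p'; elim=> {u v} [x y m|c u v u1 v1 _ IH _ IH1]; last first.
  by rewrite !dotDl !dotZl IH IH1.
elim: p' => {u' v'} [x' y' m'|c u v u1 v1 _ IH _ IH1]; last first.
  by rewrite !dotDr !dotZr IH IH1.
exact: mono_pair_dot.
Qed.

Lemma poly_pair_mul x y u v :
  mono_pair x y -> poly_pair u v -> poly_pair (x u) (y v).
Proof.
move=> m; have [Ax Ay] := mono_pair_in m.
have lx := ((vN_star vA).1 _ Ax).1; have ly := ((vN_star vA).1 _ Ay).1.
elim=> {u v} [x' y' m'|c u v u1 v1 _ IH _ IH1].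
  exact: (poly_mono (mono_pair_comp m m')).
by rewrite lx ly; exact: poly_lincomb.
Qed.

Lemma poly_pair0 : poly_pair 0 0.
Proof.
have p := poly_mono mono_id.
by rewrite -[0](addNr xi) -scaleN1r; exact: (poly_lincomb (-1) p p).
Qed.

Lemma poly_pair_isometry : exists U, [/\ bounded_op U,
  forall u v, poly_pair u v -> U u = v,
  forall k, orthocomp [set u | exists v, poly_pair u v] k -> U k = 0,
  forall u v, poly_pair u v -> adj U v = u &
  forall k, orthocomp [set v | exists u, poly_pair u v] k -> adj U k = 0].
Proof.
pose G := [set p : H * H | poly_pair p.1 p.2].
have G1 : [set p.1 | p in G] = [set u | exists v, poly_pair u v].
  apply/seteqP; split=> [_ [[u v] p <-]|u [v p]]; first by exists v.
  by exists (u, v).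
have G2 : [set p.2 | p in G] = [set v | exists u, poly_pair u v].
  apply/seteqP; split=> [_ [[u v] p <-]|v [u p]]; first by exists u.
  by exists (u, v).
have [|||U [bU U1 U0 V1 V0]] := @partial_isometry _ _ G.
- exact: poly_pair0.
- by move=> c p q; exact: poly_lincomb.
- by move=> p q; exact: poly_pair_dot.
rewrite G1 in U0; rewrite G2 in V0.
exists U; split=> // u v p; [exact: (U1 (u, v))|exact: (V1 (u, v))].
Qed.

End MonomialPairs.

(** * The spatial isomorphism *)

Section SpatialIsomorphism.
Variables (R : realType) (H : hilbertType R) (P : tracial_space H).

(** Since E is in M' and fixes xi, x xi = x E xi = E x xi for x in M''. So D and M'' xi have the
    same closure, the fixed space of E. *)
Lemma L2_fixed (M : set (H -> H)) (D : set H) E v : star_closed M ->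
  subspace D -> D (one_vec P) ->
  D `<=` [set x (one_vec P) | x in commutant (commutant M)] ->
  commutant M E -> (forall d, D d -> E d = d) ->
  (forall k, orthocomp D k -> E k = 0) ->
  L2 P (commutant (commutant M)) v <-> E v = v.
Proof.
move=> sM sD Dxi DM cE ED E0; split.
  apply: eq_on_closure => [||_ [x cx <-]]; [exact: cE.1|exact: bounded_op_id|].
  by rewrite -(commutantE _ cx cE) ED.
move=> Ev; have := (projection_closure v sD cE.1 ED E0).2 Ev.
by apply: closure_subset.
Qed.

Variables (a1 a2 : set (H * H)) (r1 r2 : bool -> H -> H).
Hypotheses (af1 : affiliated_sa (algA P) a1) (af2 : affiliated_sa (algA P) a2).
Hypothesis hr1 : forall e, shift_inverse a1 (signed_i R e) (r1 e).
Hypothesis hr2 : forall e, shift_inverse a2 (signed_i R e) (r2 e).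
Hypothesis G12 : forall n : nat, (0 < n)%N -> forall b : 'M[H -> H]_(2 * n),
  Omega (algB P) b -> cauchy_transform P a1 b = cauchy_transform P a2 b.

Let vA := algA_vN P.
Let vB := algB_vN P.
Let xi := one_vec P.

Definition generators (a : set (H * H)) : set (H -> H) :=
  algB P `|` shift_inverse a 'i `|` shift_inverse a (- 'i).

Lemma generators_cases a r x : (forall e, shift_inverse a (signed_i R e) (r e)) ->
  generators a x -> algB P x \/ exists e, x = r e.
Proof.
move=> hr [[Bx|hx]|hx]; [by left|right..].
  by exists false; exact: shift_inverse_uniq hx (hr false).
by exists true; exact: shift_inverse_uniq hx (hr true).
Qed.

Lemma generators_shift a r e : (forall e, shift_inverse a (signed_i R e) (r e)) ->
  generators a (r e).
Proof. by move=> hr; case: e; [right|left; right]; exact: hr. Qed.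

Lemma generators_in a : affiliated_sa (algA P) a -> generators a `<=` algA P.
Proof.
move=> af x [[/algB_sub//|hx]|hx].
  exact: (@affiliated_shift_inverse _ _ _ _ false _ vA af hx).
exact: (@affiliated_shift_inverse _ _ _ _ true _ vA af hx).
Qed.

Lemma generators_star a r : affiliated_sa (algA P) a ->
  (forall e, shift_inverse a (signed_i R e) (r e)) -> star_closed (generators a).
Proof.
move=> af hr; split=> [x /(generators_in af)|x].
  exact: (vN_star vA).1.
move=> /(generators_cases hr)[Bx|[e ->]].
  by left; left; exact: (vN_star vB).2.
by rewrite (shift_adj _ af.2 hr); exact: generators_shift.
Qed.

Let sM1 := generators_star af1 hr1.
Let sM2 := generators_star af2 hr2.

Lemma generators_mono1 x : generators a1 x ->
  exists2 y, generators a2 y & mono_pair P r1 r2 x y.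
Proof.
move=> /(generators_cases hr1)[Bx|[e ->]].
  exists x; first by left; left.
  rewrite -[x]/(x \o id); exact: mono_B (mono_id _ _ _).
exists (r2 e); first exact: generators_shift.
exact: (mono_r e (mono_id _ _ _)).
Qed.

Lemma generators_mono2 y : generators a2 y ->
  exists2 x, generators a1 x & mono_pair P r1 r2 x y.
Proof.
move=> /(generators_cases hr2)[By|[e ->]].
  exists y; first by left; left.
  rewrite -[y]/(y \o id); exact: mono_B (mono_id _ _ _).
exists (r1 e); first exact: generators_shift.
exact: (mono_r e (mono_id _ _ _)).
Qed.

Lemma mono_pair_bicommutant x y : mono_pair P r1 r2 x y ->
  commutant (commutant (generators a1)) x /\
  commutant (commutant (generators a2)) y.
Proof.
have s1 := sub_bicommutant sM1.1; have s2 := sub_bicommutant sM2.1.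
elim=> {x y} [|b x y Bb _ [cx cy]|e x y _ [cx cy]].
- by split; exact: commutant_id.
- by split; apply: commutant_comp => //; [apply: s1|apply: s2]; left; left.
- by split; apply: commutant_comp => //; [apply: s1|apply: s2]; exact: generators_shift.
Qed.

Lemma poly_pair_bicommutant u v : poly_pair P r1 r2 u v ->
  [set x xi | x in commutant (commutant (generators a1))] u /\
  [set y xi | y in commutant (commutant (generators a2))] v.
Proof.
elim=> {u v} [x y /mono_pair_bicommutant[cx cy]|]; first by split; [exists x|exists y].
move=> c _ _ _ _ _ [[x cx <-] [y cy <-]] _ [[x' cx' <-] [y' cy' <-]].
split; [exists (c *: x + x')|exists (c *: y + y')] => //.
  by apply: commutant_lincomb => //; exact: commutant_bounded.
by apply: commutant_lincomb => //; exact: commutant_bounded.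
Qed.

Lemma generators_total a : affiliated_sa (algA P) a ->
  total [set n xi | n in commutant (generators a)].
Proof.
move=> af; have sub : [set m xi | m in commutant (algA P)] `<=`
    [set n xi | n in commutant (generators a)].
  move=> _ [m cm <-]; exists m => //.
  exact: commutant_sub (generators_in af) _ cm.
apply: (@total_sub _ _ _ _ sub).
exact: one_vec_commutant_total.
Qed.

(** The situation is symmetric in U and its adjoint, so lifting along each of them gives the two
    inclusions. *)
Lemma bicommutants_isomorphic : spatially_isomorphic P
  (commutant (commutant (generators a1))) (commutant (commutant (generators a2))).
Proof.
have [U [bU U1 U0 V1 V0]] := poly_pair_isometry af1 af2 hr1 hr2 G12.
pose D1 := [set u | exists v, poly_pair P r1 r2 u v].
pose D2 := [set v | exists u, poly_pair P r1 r2 u v].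
have p0 := poly_pair0 P r1 r2; have pxi := poly_mono (mono_id P r1 r2).
have sD1 : subspace D1.
  split=> [|c u u' [v p] [v' p']]; first by exists 0.
  by exists (c *: v + v'); exact: poly_lincomb.
have sD2 : subspace D2.
  split=> [|c v v' [u p] [u' p']]; first by exists 0.
  by exists (c *: u + u'); exact: poly_lincomb.
have tD1 := total_orthocomp sD1.1; have bV := adj_bounded bU.
have Ax x y : mono_pair P r1 r2 x y -> bounded_op x /\ bounded_op y.
  by move=> /(mono_pair_in af1 af2 hr1 hr2)[/(vN_star vA).1 bx /(vN_star vA).1 by_].
have UM x y v : mono_pair P r1 r2 x y -> U (x v) = y (U v).
  move=> m; have [bx by_] := Ax _ _ m.
  suff : U \o x = y \o U by move/(congr1 (fun f => f v)).
  apply: (eq_on_total tD1) => [||_ [u [w p] [k k0 <-]]] /=.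
  - exact: bounded_op_comp.
  - exact: bounded_op_comp.
  rewrite (linD _ _ bx.1) !(linD _ _ bU.1) (U0 k)// addr0 (U1 _ _ p).
  (* The orthocomplement of [D1] is stable under [x], because the adjoint of a monomial is a
     monomial and preserves [D1]. *)
  rewrite (U1 _ _ (poly_pair_mul af1 af2 hr1 hr2 m p)) U0 ?addr0// => d [d' pd].
  rewrite (dot_adjl _ _ bx); apply: k0; exists (adj y d').
  by apply: (poly_pair_mul af1 af2 hr1 hr2) => //; exact: (mono_pair_adj af1 af2 hr1 hr2).
have VM x y v : mono_pair P r1 r2 x y -> adj U (y v) = x (adj U v).
  move=> m; have [bx by_] := Ax _ _ m; apply: dot_inj => z.
  rewrite -(dot_adjr _ _ bU) (dot_adjl _ _ by_) (dot_adjl _ _ bx).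
  rewrite -(dot_adjr _ _ bU); congr (dot H _ _); apply/esym/UM.
  exact: (mono_pair_adj af1 af2 hr1 hr2).
have UVU : U \o adj U \o U = U.
  apply: (eq_on_total tD1) => [||_ [u [w p] [k k0 <-]]] //=.
    by apply: bounded_op_comp => //; exact: bounded_op_comp.
  by rewrite (linD _ _ bU.1) (U0 k)// addr0 (U1 _ _ p) (V1 _ _ p) (U1 _ _ p).
have VUV : adj U \o adj (adj U) \o adj U = adj U.
  rewrite (adjK bU); apply/funext => v /=; apply: dot_inj => z.
  rewrite -!(dot_adjr _ _ bU) (dot_adjl _ _ bU) -(dot_adjr _ _ bU).
  by rewrite -[U (adj U (U z))]/((U \o adj U \o U) z) UVU.
have c1 n : commutant (generators a2) n ->
    commutant (generators a1) (adj U \o n \o U).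
  move=> cn; apply: commutantI.
    by apply: bounded_op_comp => //; apply: bounded_op_comp => //; exact: cn.1.
  move=> x v /generators_mono1[y gy m] /=.
  by rewrite (UM _ _ _ m) (commutantE _ cn gy) (VM _ _ _ m).
have c2 n : commutant (generators a1) n ->
    commutant (generators a2) (U \o n \o adj U).
  move=> cn; apply: commutantI.
    by apply: bounded_op_comp => //; apply: bounded_op_comp => //; exact: cn.1.
  move=> y v /generators_mono2[x gx m] /=.
  by rewrite (VM _ _ _ m) (commutantE _ cn gx) (UM _ _ _ m).
have Uxi : U xi = xi by exact: U1 pxi.
have Vxi : adj U xi = xi by exact: V1 pxi.
have L1 v : L2 P (commutant (commutant (generators a1))) v <-> adj U (U v) = v.
  apply: (@L2_fixed _ D1 (adj U \o U)) => //.
  - by exists xi.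
  - by move=> u [w /poly_pair_bicommutant[]].
  - exact: c1 (commutant_id _).
  - by move=> u [w p] /=; rewrite (U1 _ _ p) (V1 _ _ p).
  - by move=> k k0 /=; rewrite (U0 k)// (lin0 bV.1).
have L2' v : L2 P (commutant (commutant (generators a2))) v <-> U (adj U v) = v.
  apply: (@L2_fixed _ D2 (U \o adj U)) => //.
  - by exists xi.
  - by move=> w [u /poly_pair_bicommutant[]].
  - exact: c2 (commutant_id _).
  - by move=> w [u p] /=; rewrite (V1 _ _ p) (U1 _ _ p).
  - by move=> k k0 /=; rewrite (V0 k)// (lin0 bU.1).
have L1x x v : commutant (commutant (generators a1)) x ->
    adj U (U v) = v -> adj U (U (x v)) = x v.
  move=> cx vE; have := commutantE v cx (c1 _ (commutant_id _)).
  by rewrite /= vE => <-.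
exists U; split.
- split=> [c x y _ _|x y /L1 xE _|]; first exact: bU.1.
    by rewrite (dot_adjl _ _ bU) xE.
  apply/seteqP; split=> [_ [x /L1 xE <-]|y /L2' yE].
    by apply/L2'; rewrite xE.
  by exists (adj U y) => //; apply/L1; rewrite yE.
- move=> x cx; have [y cy yE] := lift_ex sM1 sM2 bU UVU c1
    (c2 _ (commutant_id _)) Uxi Vxi (generators_total af2) cx.
  by exists y => // v /L1 vE; rewrite yE vE.
- move=> y cy; have c2' n : commutant (generators a1) n ->
      commutant (generators a2) (adj (adj U) \o n \o adj U).
    by rewrite (adjK bU); exact: c2.
  have c1' : commutant (generators a1) (adj U \o adj (adj U)).
    by rewrite (adjK bU); exact: c1 (commutant_id _).
  have Vxi' : adj (adj U) xi = xi by rewrite (adjK bU).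
  have [x cx xE] := lift_ex sM2 sM1 bV VUV c2' c1' Vxi Vxi'
    (generators_total af1) cy.
  exists x => // v /L1 vE; have := xE (U v).
  rewrite (adjK bU) vE => ->.
  (* U U^* lies in the commutant of the second generators, so it moves across [y] and is absorbed by
     [U v]. *)
  have := commutantE (U v) cy (c2 _ (commutant_id _)) => /= <-.
  by rewrite vE.
Qed.

End SpatialIsomorphism.

Theorem theorem3p3 (R : realType) (H : hilbertType R) (P : tracial_space H)
    (a1 a2 : set (H * H)) :
  affiliated_sa (algA P) a1 ->
  affiliated_sa (algA P) a2 ->
  (forall n : nat, (0 < n)%N -> forall b : 'M[H -> H]_(2 * n),
     Omega (algB P) b ->
     cauchy_transform P a1 b = cauchy_transform P a2 b) ->
  spatially_isomorphic P (vN_adjoin a1 (algB P)) (vN_adjoin a2 (algB P)).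
Proof.
move=> af1 af2 G12.
have [r1 hr1] := choice (fun e =>
  shift_inverse_ex af1.2 (conj_signed_i R e) (signed_i_norm R e)).
have [r2 hr2] := choice (fun e =>
  shift_inverse_ex af2.2 (conj_signed_i R e) (signed_i_norm R e)).
rewrite /vN_adjoin !generated_vN_bicommutant.
- exact: bicommutants_isomorphic.
- exact: generators_star.
- exact: generators_star.
Qed.
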